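(* Let the training set $\mathcal{S}$, the hypothesis class $\mathcal{H}^1$ (compressed neural networks), the loss $\ell$, the empirical risk $\hat{\mathcal L}$ and the true loss $\mathcal{L}$ be as in the context, with $\frac{\omega_2}{\omega_1}n_rr\le n_c$. Then for any $\delta\in(0,1)$ and $h\in\mathcal{H}^1$, with probability of at least $1-\delta$, $$\mathcal{L}(h)\leq \hat{\mathcal{L}}(h)+2^2\Big(\sqrt{2\ln(4\delta^{-1})}\,(B_{out}+B_{tgt})+2^6\cdot 3 \sqrt{2}\,B_{out}\, \alpha^{-1}\big(1+c_1 B_{out}^{-1} n_c^{-\frac32}\big)^\frac12 n_c^3\Big)N^{-\frac12},$$ with the constant $c_1:=2^6\pi^2 (c_{\omega_1}+c_{\omega_2})(B_D^4+1)^\frac12 B_U^2 B_M^2 B_V^2 B_{in}$.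
   Context: Fixed: $0<\omega_1<\omega_2$ with $\omega_2/\omega_1\in\mathbb{N}$, $c_\omega=\frac{e^{i\pi/4}\omega^2}{\sqrt{8\pi\omega}}$ (in the constant $c_1$, $c_{\omega_1}$ and $c_{\omega_2}$ enter as positive numbers, i.e. through their moduli), $\alpha>0$, positive integers with $n_c=n_\theta=\frac{\omega_1}{\omega_2}n_\rho$, positive integers $r,n_r$ with $\frac{n_\theta}{n_r},\frac{n_\rho}{n_r}\in\mathbb{N}$, and positive constants $B_{in},B_{tgt},B_{out},B_U,B_M,B_V,B_D$. $\|\cdot\|_F$ is the Frobenius norm, $\|\cdot\|_2$ the spectral norm, $A^*$ the conjugate transpose, $\mathrm{diag}(A)$ the row vector of diagonal entries of a matrix $A$. Matrices: $P_u=[I_{n_\theta}\;O_{n_\theta\times n_\theta}]$, $P_l=[O_{n_\theta\times n_\theta}\;I_{n_\theta}]$; $P_\omega\in\mathbb{R}^{n_\rho\times n_c}$ with $P_\omega[i,j]=1$ if $i=\frac{\omega}{\omega_1}j$ and $0$ otherwise. For $\Lambda=\begin{bmatrix}\Lambda^{\omega_1}\\\Lambda^{\omega_2}\end{bmatrix}\in\mathbb{C}^{2n_\theta\times n_\theta}$ and $1\le m\le n_\theta$, $R_m^{\omega}(\Lambda)=\Lambda^\omega_{\theta_m}\in\mathbb{C}^{n_\theta\times n_\theta}$, $\Lambda^\omega_{\theta_m}[i,j]=\Lambda^\omega[i+m,j+m]$ (indices mod $n_\theta$), $\omega\in\{\omega_1,\omega_2\}$. $\mathcal{H}^1_{BFNN}$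 is the set of maps $\phi^1$ on $\mathbb{C}^{2n_\theta\times n_\theta}$ given by $$\phi^1(\Lambda)=\sum_{i=1}^2 \Big(P_u^T \big(\phi_1^1 R_1^{\omega_i}(\Lambda),\cdots,\phi_1^1 R_{n_\theta}^{\omega_i}(\Lambda) \big)^T P_{\omega_i}+ P_l^T \big(\phi_2^1 R_1^{\omega_i}(\Lambda),\cdots,\phi_2^1 R_{n_\theta}^{\omega_i}(\Lambda)\big)^T P_{\omega_i}\Big),$$ where $(v_1,\dots,v_{n_\theta})^T$ is the matrix with $m$-th row $v_m$ and $$\phi_1^1\Lambda_{\theta_m}^\omega=-\frac{2\pi^2 c_{\omega}}{n_\theta^2}{\rm diag}\big(V^*M^*U^* ( D^*\Lambda_{\theta_m}^{\omega}D+D\Lambda_{\theta_m}^{\omega}D^* ) UMV\big),\quad \phi_2^1\Lambda_{\theta_m}^\omega=\frac{4\pi^2 c_{\omega}}{n_\theta^2}{\rm diag}\big(V^*M^*U^* \Lambda_{\theta_m}^{\omega} UMV\big),$$ with parameters: $U$ block diagonal with diagonal blocks $U_1,\dots,U_{n_r}\in\mathbb{C}^{\frac{n_\theta}{n_r}\times n_rr}$; $V$ block diagonal with diagonal blocks $V_1,\dots,V_{n_r}\in\mathbb{C}^{n_rr\times\frac{n_\rho}{n_r}}$; $M=(M_{ij})_{i,j=1}^{n_r}$ with $M_{ij}=(M^{ij}_{mn})_{m,n=1}^{n_r}$, $M^{ij}_{ji}\in\mathbb{C}^{r\times r}$ and $M^{ij}_{mn}=O_{r\times r}$ otherwise; $D\in\mathbb{C}^{n_\theta\times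 n_\theta}$; and $\|U\|_2\le B_U$, $\|V\|_2\le B_V$, $\|M\|_2\le B_M$, $\|D\|_2\le B_D$. $\mathcal{H}^1=\{h=\psi\circ\psi_0\circ\phi^1:\ \|\psi\|\le2\alpha^{-1},\ \|\psi_0\|\le2,\ \phi^1\in\mathcal{H}^1_{BFNN}\}$, where $\psi$ (convolutional part) and $\psi_0$ (change from polar to Cartesian coordinates) are linear operators on $2n_c\times n_c$ matrices and $\|\cdot\|$ is the operator norm with respect to $\|\cdot\|_F$. Data: $\mathcal{S}=\{(\Lambda_s,(\gamma_s,\eta_s)^T)\}_{s=1}^N$, with inputs $\Lambda_s\in\mathbb{C}^{2n_\theta\times n_\theta}$ and targets $(\gamma_s,\eta_s)^T\in\mathbb{R}^{2n_c\times n_c}$, drawn i.i.d. from a probability distribution $\mu=\mu_1\times\mu_2$, with $\|\Lambda_s\|_F\le B_{in}$ and $\|(\gamma_s,\eta_s)^T\|_F\le B_{tgt}$. It is assumed that the network outputs are real, $\phi^1(\Lambda_s)\in\mathbb{R}^{2n_c\times n_c}$, that $\|h(\Lambda_s)\|_F\le B_{out}$ for all $h\in\mathcal{H}^1$, and that $\|\phi^1(\Lambda_s)\|_F\le B_{out}$ for all $\phi^1\in\mathcal{H}^1_{BFNN}$. Loss: $\ell(h,\Lambda,(\gamma,\eta)^T)=\|h(\Lambda)-(\gamma,\eta)^T\|_F$; $\hat{\mathcal L}(h)=\frac1N\sum_{s=1}^N\ell(h,\Lambda_s,(\gamma_s,\eta_s)^T)$; $\mathcal{L}(h)=\mathbb{E}_{(\Lambda,(\gamma,\eta)^T)\sim\mu}[\ell(h,\Lambda,(\gamma,\eta)^T)]$.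 The probability is over the draw of $\mathcal{S}$. *)

(* Defs.v *)
From HB Require Import structures.
From mathcomp Require Import all_boot all_order all_algebra.
From mathcomp Require Import sesquilinear spectral.
From mathcomp Require Import all_classical all_reals all_analysis.
From mathcomp Require Import complex.

Set Implicit Arguments.
Unset Strict Implicit.
Unset Printing Implicit Defensive.

Import Order.TTheory GRing.Theory Num.Theory.
Import numFieldNormedType.Exports.
Import ComplexField.Normc.

Local Open Scope classical_set_scope.
Local Open Scope ring_scope.
Local Open Scope complex_scope.
Local Open Scope sesquilinear_scope.

(* Throughout, [n] is the common value of n_theta and n_c. *)

HB.instance Definition _ (R : realType) := isPointed.Build R[i] 0.

(* The Borel sigma-algebras, generated by the real coordinates of a matrix. *)

Definition real_coordinate_preimages (R : realType) (m n : nat) :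
    set (set 'M[R]_(m, n)) :=
  [set A : set 'M[R]_(m, n) | exists i j, exists2 B : set R, measurable B &
     A = [set X | B (X i j)]].

Definition complex_coordinate_preimages (R : realType) (m n : nat) :
    set (set 'M[R[i]]_(m, n)) :=
  [set A : set 'M[R[i]]_(m, n) | exists i j, exists2 B : set R, measurable B &
     A = [set X | B (complex.Re (X i j))] \/
     A = [set X | B (complex.Im (X i j))]].

Definition inputs (R : realType) (n : nat) :=
  g_sigma_algebraType (@complex_coordinate_preimages R (n + n) n).

Definition targets (R : realType) (n : nat) :=
  g_sigma_algebraType (@real_coordinate_preimages R (n + n) n).

Definition frobenius (R : realType) (m n : nat) (A : 'M[R]_(m, n)) : R :=
  Num.sqrt (\sum_i \sum_j A i j ^+ 2).

Definition frobeniusC (R : realType) (m n : nat) (A : 'M[R[i]]_(m, n)) : R :=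
  Num.sqrt (\sum_i \sum_j normc (A i j) ^+ 2).

(* On column vectors [frobeniusC] is the Euclidean norm. *)
Definition spectral_norm (R : realType) (m n : nat) (A : 'M[R[i]]_(m, n)) : R :=
  sup [set frobeniusC (A *m x) | x in [set x : 'cV_n | frobeniusC x <= 1]].

Definition op_norm (R : realType) (m n p q : nat)
    (f : 'M[R]_(m, n) -> 'M[R]_(p, q)) : R :=
  sup [set frobenius (f X) | X in [set X | frobenius X <= 1]].

(* [A] is block diagonal with diagonal blocks of size a x b. *)
Definition block_diagonal (R : realType) (a b m n : nat)
    (A : 'M[R[i]]_(m, n)) : Prop :=
  forall (i : 'I_m) (j : 'I_n), (i %/ a != j %/ b)%N -> A i j = 0.

(* Row p lies in row [(p %/ r) %% nr] of r x r blocks inside the block row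
   [p %/ (nr * r)], and likewise for columns; the only blocks M^{ij}_{mn} that
   may be nonzero are those with (m, n) = (j, i). *)
Definition switch_matrix (R : realType) (nr r : nat)
    (M : 'M[R[i]]_(nr * (nr * r))) : Prop :=
  forall p q : 'I_(nr * (nr * r)),
    ~~ (((p %/ r) %% nr == q %/ (nr * r)) &&
        ((q %/ r) %% nr == p %/ (nr * r)))%N ->
    M p q = 0.

Definition c_freq (R : realType) (w : R) : R[i] :=
  (cos (pi / 4) +i* sin (pi / 4)) * (w ^+ 2 / Num.sqrt (8 * pi * w))%:C.

(* The matrix entries are numbered from 1 in the condition i = (w / w1) j. *)
Definition P_freq (R : realType) (w1 w : R) (nrho n : nat) :
    'M[R[i]]_(nrho, n) :=
  \matrix_(i < nrho, j < n)
    (if i.+1%:R == w / w1 * j.+1%:R then 1 else 0).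

Definition P_upper (R : realType) (n : nat) : 'M[R[i]]_(n, n + n) :=
  row_mx 1%:M 0.

Definition P_lower (R : realType) (n : nat) : 'M[R[i]]_(n, n + n) :=
  row_mx 0 1%:M.

(* The theta_m-shift [L[i + m, j + m]], indices modulo n. *)
Definition shift_mx (R : realType) (n m : nat) (L : 'M[R[i]]_n) : 'M[R[i]]_n :=
  \matrix_(i < n, j < n) L (iter m (@ordS n) i) (iter m (@ordS n) j).

Definition diag_row (R : realType) (n : nat) (A : 'M[R[i]]_n) : 'rV[R[i]]_n :=
  \row_j A j j.

Section Network.
Context (R : realType) (n nrho k : nat) (w1 w2 : R).
Context (U : 'M[R[i]]_(n, k)) (M : 'M[R[i]]_k) (V : 'M[R[i]]_(k, nrho))
  (D : 'M[R[i]]_n).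

Definition phi11 (w : R) (L : 'M[R[i]]_n) : 'rV[R[i]]_nrho :=
  - ((2 * pi ^+ 2)%:C * c_freq w / (n%:R ^+ 2)) *:
  diag_row (V ^t* *m M ^t* *m U ^t* *m (D ^t* *m L *m D + D *m L *m D ^t*)
            *m U *m M *m V).

Definition phi12 (w : R) (L : 'M[R[i]]_n) : 'rV[R[i]]_nrho :=
  ((4 * pi ^+ 2)%:C * c_freq w / (n%:R ^+ 2)) *:
  diag_row (V ^t* *m M ^t* *m U ^t* *m L *m U *m M *m V).

(* The summand for frequency [w], where [L] is the corresponding half of the
   data; the row numbered m (from 1) uses the shift by m. *)
Definition bfnn_term (w : R) (L : 'M[R[i]]_n) : 'M[R[i]]_(n + n, n) :=
  (P_upper R n)^T *m (\matrix_(m < n) phi11 w (shift_mx m.+1 L))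
    *m P_freq w1 w nrho n +
  (P_lower R n)^T *m (\matrix_(m < n) phi12 w (shift_mx m.+1 L))
    *m P_freq w1 w nrho n.

Definition bfnn (L : 'M[R[i]]_(n + n, n)) : 'M[R[i]]_(n + n, n) :=
  bfnn_term w1 (usubmx L) + bfnn_term w2 (dsubmx L).

End Network.

Definition H_BFNN (R : realType) (n nrho nr r : nat)
    (w1 w2 BU BM BV BD : R) :
    set ('M[R[i]]_(n + n, n) -> 'M[R[i]]_(n + n, n)) :=
  [set phi |
    exists (U : 'M[R[i]]_(n, nr * (nr * r))) (M : 'M[R[i]]_(nr * (nr * r)))
           (V : 'M[R[i]]_(nr * (nr * r), nrho)) (D : 'M[R[i]]_n),
    [/\ [/\ block_diagonal (n %/ nr) (nr * r) U,
            block_diagonal (nr * r) (nrho %/ nr) V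
          & switch_matrix M],
        [/\ spectral_norm U <= BU, spectral_norm V <= BV,
            spectral_norm M <= BM & spectral_norm D <= BD]
      & phi = bfnn w1 w2 U M V D]].

(* The operators psi, psi0 act on real matrices. The entrywise real part only
   converts the type: under the standing assumption that the outputs of phi are
   real on the data, it is the identity there. *)
Definition H_net (R : realType) (n nrho nr r : nat)
    (w1 w2 alpha BU BM BV BD : R) :
    set ('M[R[i]]_(n + n, n) -> 'M[R]_(n + n, n)) :=
  [set h |
    exists (psi psi0 : {linear 'M[R]_(n + n, n) -> 'M[R]_(n + n, n)}),
    exists2 phi, H_BFNN nrho nr r w1 w2 BU BM BV BD phi &
    [/\ op_norm psi <= 2 * alpha^-1, op_norm psi0 <= 2
      & h = fun L => psi (psi0 (map_mx (@complex.Re R) (phi L)))]].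

Definition loss (R : realType) (n : nat)
    (h : 'M[R[i]]_(n + n, n) -> 'M[R]_(n + n, n))
    (z : inputs R n * targets R n) : R :=
  frobenius (h z.1 - z.2).

Definition empirical_loss (R : realType) (n N : nat)
    (S : 'I_N -> inputs R n * targets R n)
    (h : 'M[R[i]]_(n + n, n) -> 'M[R]_(n + n, n)) : R :=
  N%:R^-1 * \sum_(s < N) loss h (S s).

Definition true_loss (R : realType) (n : nat)
    (mu : probability (inputs R n * targets R n)%type R)
    (h : 'M[R[i]]_(n + n, n) -> 'M[R]_(n + n, n)) : \bar R :=
  'E_mu [loss h].

Definition iid (d d' : measure_display) (T : measurableType d)
    (E : measurableType d') (R : realType) (P : probability T R)
    (mu : probability E R) (N : nat) (Z : 'I_N -> {RV P >-> E}) : Prop :=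
  (forall s (A : set E), measurable A -> distribution P (Z s) A = mu A) /\
  (forall A : 'I_N -> set E, (forall s, measurable (A s)) ->
     P (\bigcap_(s in [set: 'I_N]) (Z s @^-1` A s)) =
     (\prod_(s < N) P (Z s @^-1` A s))%E).

Definition c1_const (R : realType) (w1 w2 BU BM BV BD Bin : R) : R :=
  2 ^+ 6 * pi ^+ 2 * (normc (c_freq w1) + normc (c_freq w2)) *
  (BD ^+ 4 + 1) `^ (2^-1) * BU ^+ 2 * BM ^+ 2 * BV ^+ 2 * Bin.

(* Main.v *)
(** Only two properties of a network h matter: it is real-linear in the data,
    and |h| <= B := 4 Bout / alpha on almost all inputs, because the operators
    psi and psi0 have norms at most 2 / alpha and 2 and |phi| <= Bout. The
    data space is cut into finitely many cells on which all the losses are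
    almost constant, uniformly in h, so that a sample becomes a word over a
    finite alphabet and suprema over the class raise no measurability issue.
    On words, the supremum over h of the deviations changes by at most
    Bout + Btgt when one letter changes, hence it concentrates around its
    mean. Symmetrization and contraction bound the mean by that of the
    supremum of a random linear functional of the coefficient matrix of h,
    which AM-GM splits into a second moment of h, at most 2 B^2, and a dual
    quadratic form, whose mean is at most a multiple of the dimension 4 n^2 of
    the input space. This gives a capacity term 48 n^3 Bout / (alpha sqrt N),
    far below the announced one, and the gap pays for the discretization. *)

Require Import Defs.
From HB Require Import structures.
From mathcomp Require Import all_boot all_order all_algebra.
From mathcomp Require Import sesquilinear spectral.
From mathcomp Require Import all_classical all_reals all_analysis.
From mathcomp Require Import complex.
From mathcomp Require Import measurable_realfun ring lra.

Set Implicit Arguments.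
Unset Strict Implicit.
Unset Printing Implicit Defensive.

Import Order.TTheory GRing.Theory Num.Theory.
Import numFieldNormedType.Exports.
Import ComplexField.Normc.

Local Open Scope classical_set_scope.
Local Open Scope ring_scope.

(** Up to 1/2, exp x is at most 1 / (1 - x); beyond, x itself is at most 2 x^2. The linear term
    vanishes in the mean of a centred variable, which leaves a subgaussian bound. *)
Lemma expR_le_quadratic (R : realType) (x : R) : expR x <= x + expR (2 * x ^+ 2).
Proof.
have [x2|x2] := leP x (2^-1); last first.
  have xx : x <= 2 * x ^+ 2 by nra.
  by rewrite (@le_trans _ _ (expR (2 * x ^+ 2)))// ?ler_expR// lerDr; lra.
apply: (@le_trans _ _ (x + (1 + 2 * x ^+ 2))); last by rewrite lerD2l expR_ge1Dx.
rewrite -[x in expR x]opprK expRN.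
have x1 : 0 < 1 - x by lra.
apply: (@le_trans _ _ (1 - x)^-1); first by rewrite lef_pV2 ?posrE ?expR_gt0// expR_ge1Dx.
by rewrite -div1r ler_pdivrMr//; nra.
Qed.

(** * Suprema over a class and their exponential moments over finite samples *)

Section Suprema.
Context (R : realType) (H : Type) (h0 : H).
Implicit Types (a b u : H -> R) (Phi Psi : (H -> R) -> R).

Definition bounded_above a := exists K, forall h, a h <= K.

Lemma bounded_aboveD a b :
  bounded_above a -> bounded_above b -> bounded_above (a \+ b).
Proof. by move=> [K aK] [L bL]; exists (K + L) => h; rewrite lerD. Qed.

Definition supf a : R := sup (range a).

Lemma supf_ge a h : bounded_above a -> a h <= supf a.
Proof.
move=> [K aK]; apply: ub_le_sup; last by exists h.
by exists K => _ [g _ <-].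
Qed.

Lemma supf_le a K : (forall h, a h <= K) -> supf a <= K.
Proof.
by move=> aK; apply: ge_sup; [exists (a h0), h0|move=> _ [g _ <-]].
Qed.

Lemma supf_le_shift a b c : bounded_above b ->
  (forall h, a h <= b h + c) -> supf a <= supf b + c.
Proof.
move=> bb ab; apply: supf_le => h; apply: le_trans (ab h) _.
by rewrite lerD2r supf_ge.
Qed.

(* The mean of Phi after one random increment of its argument; iterating it
   gives the mean over a sample. *)
Definition step (J : finType) (p : J -> R) (u : J -> H -> R) Phi a : R :=
  \sum_j p j * Phi (a \+ u j).

(** Drawing a word of length N + 1 means drawing its head and then its tail, so iterated steps
    become weighted sums over words. *)
Lemma iter_step_sum (J : finType) (p : J -> R) (u : J -> H -> R) Phi N a :
  iter N (step p u) Phi a =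
  \sum_(t : N.-tuple J)
    (\prod_s p (tnth t s)) * Phi (fun h => a h + \sum_s u (tnth t s) h).
Proof.
elim: N a => [|N IH] a /=.
  rewrite (big_pred1 [tuple]) => [|t]; last by rewrite [t]tuple0 /= eqxx.
  by rewrite big_ord0 mul1r; congr Phi; apply/funext => h; rewrite big_ord0 addr0.
rewrite (reindex (fun z : J * N.-tuple J => [tuple of z.1 :: z.2])) /=; last first.
  exists (fun t : N.+1.-tuple J => (thead t, [tuple of behead t])).
    by move=> [j t] _; congr pair; apply/val_inj.
  by move=> t _; rewrite [RHS]tuple_eta.
rewrite -(pair_bigA _ (fun j (t : N.-tuple J) =>
  (\prod_s p (tnth [tuple of j :: t] s)) *
  Phi (fun h => a h + \sum_s u (tnth [tuple of j :: t] s) h))) /=.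
apply: eq_bigr => j _; rewrite IH mulr_sumr; apply: eq_bigr => t _.
rewrite mulrA big_ord_recl /= tnth0; congr (_ * Phi _).
  by congr (_ * _); apply: eq_bigr => s _; rewrite tnthS.
apply/funext => h; rewrite big_ord_recl tnth0 addrA; congr (_ + _).
by apply: eq_bigr => s _; rewrite tnthS.
Qed.

Lemma step_comm (J K : finType) (p : J -> R) (w : K -> R)
    (u : J -> H -> R) (v : K -> H -> R) Phi a :
  step p u (step w v Phi) a = step w v (step p u Phi) a.
Proof.
rewrite /step; under eq_bigr do rewrite mulr_sumr.
rewrite exchange_big; apply: eq_bigr => k _; rewrite mulr_sumr.
apply: eq_bigr => j _; rewrite mulrCA; congr (_ * (_ * Phi _)).
by apply/funext => h /=; rewrite addrAC.
Qed.

Lemma iter_step_comm (J K : finType) (p : J -> R) (w : K -> R)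
    (u : J -> H -> R) (v : K -> H -> R) Phi N a :
  iter N (step p u) (step w v Phi) a = step w v (iter N (step p u) Phi) a.
Proof.
elim: N a => //= N IH a; rewrite step_comm.
by apply: eq_bigr => j _; rewrite IH.
Qed.

Lemma le_iter_step (J : finType) (p : J -> R) (u : J -> H -> R) Phi Psi N a :
  (forall j, 0 <= p j) -> (forall j, bounded_above (u j)) -> bounded_above a ->
  (forall b, bounded_above b -> Phi b <= Psi b) ->
  iter N (step p u) Phi a <= iter N (step p u) Psi a.
Proof.
move=> p_ge0 bu ba PhiPsi; elim: N a ba => [|N IH] a ba /=; first exact: PhiPsi.
apply: ler_sum => j _; rewrite ler_wpM2l// IH//.
exact: bounded_aboveD.
Qed.

(** The hypothesis compares a single step only in front of [Phi]. The increments are therefore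
    exchanged one at a time, each commuted to the innermost position first. *)
Lemma iter_step_replace (J K : finType) (p : J -> R) (w : K -> R)
    (u : J -> H -> R) (v : K -> H -> R) Phi N a :
  (forall j, 0 <= p j) -> (forall j, bounded_above (u j)) ->
  (forall k, 0 <= w k) -> (forall k, bounded_above (v k)) ->
  (forall b, bounded_above b -> step p u Phi b <= step w v Phi b) ->
  bounded_above a ->
  iter N (step p u) Phi a <= iter N (step w v) Phi a.
Proof.
move=> p0 bu w0 bv uv; elim: N a => [|N IH] a ba //.
rewrite (iterSr N (step w v)); apply: le_trans (le_iter_step _ w0 bv ba uv).
rewrite iter_step_comm /= ; apply: ler_sum => j _; rewrite ler_wpM2l// IH//.
exact: bounded_aboveD.
Qed.

Section Concentration.
Context (J : finType) (p : J -> R) (u : J -> H -> R) (c : R).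
Hypotheses (p_ge0 : forall j, 0 <= p j) (p_sum : \sum_j p j = 1).
Hypotheses (bu : forall j, bounded_above (u j)).
Hypothesis (u_le : forall i j h, u i h <= u j h + c).

Lemma iter_step_shift N a b e : bounded_above b ->
  (forall h, a h <= b h + e) ->
  iter N (step p u) supf a <= iter N (step p u) supf b + e.
Proof.
move=> bb ab; elim: N a b bb ab => [|N IH] a b bb ab /=; first exact: supf_le_shift.
rewrite -[e in leRHS]mul1r -p_sum mulr_suml -big_split /=; apply: ler_sum => j _.
rewrite -mulrDr ler_wpM2l// IH//; first exact: bounded_aboveD.
by move=> h /=; rewrite addrAC lerD2r.
Qed.

(** A Hoeffding-type estimate: the [m j] lie within c of their weighted mean, and in
    [expR_le_quadratic] at [l * (m j - mu)] the linear term averages to zero. *)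
Lemma exp_moment_weighted (m : J -> R) (l : R) : 0 <= l ->
  (forall i j, m i <= m j + c) ->
  \sum_j p j * expR (l * m j) <=
  expR (l * (\sum_j p j * m j) + 2 * (l * c) ^+ 2).
Proof.
move=> l0 mc; set mu := \sum_j p j * m j.
have dev j : `|m j - mu| <= c.
  rewrite ler_norml; apply/andP; split.
    rewrite lerNl opprB lerBlDr addrC -[leRHS]mul1r -p_sum mulr_suml.
    by apply: ler_sum => i _; rewrite ler_wpM2l.
  rewrite lerBlDr addrC -[m j]mul1r -[c]mul1r -p_sum !mulr_suml -big_split /=.
  by apply: ler_sum => i _; rewrite -mulrDr ler_wpM2l.
have H1 j : expR (l * m j) <=
    expR (l * mu) * (l * (m j - mu) + expR (2 * (l * c) ^+ 2)).
  rewrite [l * m j](_ : _ = l * mu + l * (m j - mu)); last by ring.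
  rewrite expRD ler_wpM2l ?expR_ge0//.
  apply: le_trans (expR_le_quadratic _) _; rewrite lerD2l ler_expR ler_pM2l//.
  rewrite -real_normK ?num_real// lerXn2r ?nnegrE ?mulr_ge0 ?normr_ge0//.
    by apply: le_trans (dev j).
  by rewrite normrM ger0_norm// ler_wpM2l.
rewrite expRD; apply: (@le_trans _ _ (\sum_j p j *
   (expR (l * mu) * (l * (m j - mu) + expR (2 * (l * c) ^+ 2))))).
  by apply: ler_sum => j _; rewrite ler_wpM2l.
rewrite le_eqVlt; apply/orP; left; apply/eqP; under eq_bigr do rewrite mulrCA mulrDr mulrCA.
rewrite -mulr_sumr big_split /= -mulr_suml p_sum mul1r -mulr_sumr.
under eq_bigr do rewrite mulrBr.
by rewrite sumrB -mulr_suml p_sum mul1r subrr mulr0 add0r.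
Qed.

(** Method of bounded differences, by conditioning on the first letter: the conditional means for
    two values of that letter differ by at most c, so [exp_moment_weighted] applies to them. *)
Lemma exp_moment_supf N a l : 0 <= l -> bounded_above a ->
  iter N (step p u) (fun b => expR (l * supf b)) a <=
  expR (l * iter N (step p u) supf a + 2 * N%:R * (l * c) ^+ 2).
Proof.
move=> l0; elim: N a => [|N IH] a ba; first by rewrite /= mulr0 mul0r addr0.
rewrite /= {1}/step.
apply: (@le_trans _ _ (\sum_j p j * (expR (l * iter N (step p u) supf (a \+ u j)) *
   expR (2 * N%:R * (l * c) ^+ 2)))).
  apply: ler_sum => j _; rewrite ler_wpM2l// -expRD IH//.
  exact: bounded_aboveD.
under eq_bigr do rewrite mulrA.
rewrite -mulr_suml.
rewrite [X in expR (_ + X)](_ : _ = 2 * (l * c) ^+ 2 + 2 * N%:R * (l * c) ^+ 2).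
  rewrite addrA expRD ler_wpM2r ?expR_ge0//; apply: exp_moment_weighted => // i j.
  apply: iter_step_shift => [|h /=]; first exact: bounded_aboveD.
  by rewrite -addrA lerD2l.
by rewrite -natr1; ring.
Qed.

End Concentration.
End Suprema.

(** * Second-moment matrices and their dual quadratic forms *)

Section QuadraticForms.
Context (R : realType).

Lemma mxtrace_gram m n (Y : 'M[R]_(m, n)) :
  \tr (Y *m Y^T) = \sum_i \sum_j Y i j ^+ 2.
Proof.
by apply: eq_bigr => i _; rewrite mxE; apply: eq_bigr => j _; rewrite mxE -expr2.
Qed.

Lemma mxtrace_gram_ge0 m n (Y : 'M[R]_(m, n)) : 0 <= \tr (Y *m Y^T).
Proof. by rewrite mxtrace_gram; do 2!apply: sumr_ge0 => ? _; exact: sqr_ge0. Qed.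

Context (J : finType) (p : J -> R) (q : nat) (x : J -> 'rV[R]_q) (s : R).
Hypotheses (p_ge0 : forall j, 0 <= p j) (s_gt0 : 0 < s).

(** The uncentred second-moment matrix of the rows [x j], with a ridge [s] that makes it positive
    definite even if the rows of positive weight do not span. *)
Definition moment_mx : 'M[R]_q := \sum_j p j *: ((x j)^T *m x j) + s%:M.

Local Notation A := moment_mx.

Lemma moment_mx_sym : A^T = A.
Proof.
rewrite /A linearD /= tr_scalar_mx; congr (_ + _).
rewrite raddf_sum; apply: eq_bigr => j _.
by rewrite /= linearZ /= trmx_mul trmxK.
Qed.

Lemma mxtrace_moment k (Y : 'M[R]_(k, q)) :
  \tr (Y *m A *m Y^T) =
  \sum_j p j * \tr ((Y *m (x j)^T) *m (Y *m (x j)^T)^T) + s * \tr (Y *m Y^T).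
Proof.
rewrite /A mulmxDr mulmxDl linearD /=; congr (_ + _); last first.
  by rewrite mul_mx_scalar -scalemxAl mxtraceZ.
rewrite mulmx_sumr mulmx_suml raddf_sum; apply: eq_bigr => j _ /=.
by rewrite -scalemxAr -scalemxAl mxtraceZ trmx_mul trmxK !mulmxA.
Qed.

Lemma mxtrace_moment_ge0 k (Y : 'M[R]_(k, q)) : 0 <= \tr (Y *m A *m Y^T).
Proof.
rewrite mxtrace_moment addr_ge0//; last by rewrite mulr_ge0 ?mxtrace_gram_ge0// ltW.
by apply: sumr_ge0 => j _; rewrite mulr_ge0 ?mxtrace_gram_ge0.
Qed.

Lemma moment_mx_unit : A \in unitmx.
Proof.
rewrite -row_free_unit; apply: inj_row_free => y yA.
have : \tr (y *m A *m y^T) = 0 by rewrite yA mul0mx linear0.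
rewrite mxtrace_moment => /eqP; rewrite paddr_eq0; last 2 first.
  by apply: sumr_ge0 => j _; rewrite mulr_ge0 ?mxtrace_gram_ge0.
  by rewrite mulr_ge0 ?mxtrace_gram_ge0// ltW.
case/andP => _; rewrite mulf_eq0 gt_eqF//= mxtrace_gram big_ord1.
rewrite psumr_eq0 => [/allP y0|i _]; last exact: sqr_ge0.
apply/rowP => i; rewrite mxE; apply/eqP; rewrite -sqrf_eq0.
exact: y0 (mem_index_enum _).
Qed.

(** For a single row this is the square of the norm dual to the one given by the moment matrix. *)
Definition dual_form k (g : 'M[R]_(k, q)) : R := \tr (g *m invmx A *m g^T).

Lemma invmx_moment_sym : (invmx A)^T = invmx A.
Proof. by rewrite trmx_inv moment_mx_sym. Qed.

Lemma dual_form_moment k (g : 'M[R]_(k, q)) :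
  dual_form g = \tr ((g *m invmx A) *m A *m (g *m invmx A)^T).
Proof.
by rewrite /dual_form mulmxKV ?moment_mx_unit// trmx_mul invmx_moment_sym mulmxA.
Qed.

Lemma dual_form_ge0 k (g : 'M[R]_(k, q)) : 0 <= dual_form g.
Proof. by rewrite dual_form_moment mxtrace_moment_ge0. Qed.

(** Young's inequality for matrices: expand the nonnegative form of [A] at
    [t *: C^T - g *m invmx A]. *)
Lemma mxtrace_le_dual k (g : 'M[R]_(k, q)) (C : 'M[R]_(q, k)) (t : R) :
  0 < t ->
  \tr (g *m C) <= t / 2 * \tr (C^T *m A *m C) + (2 * t)^-1 * dual_form g.
Proof.
move=> t0; have := mxtrace_moment_ge0 (t *: C^T - g *m invmx A).
rewrite dual_form_moment; set Z := g *m invmx A.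
have gE : g = Z *m A by rewrite mulmxKV ?moment_mx_unit.
have cross : \tr (C^T *m A *m Z^T) = \tr (g *m C).
  by rewrite gE -mxtrace_tr !trmx_mul !trmxK moment_mx_sym mulmxA.
rewrite linearB /= linearZ /= trmxK mulmxBl mulmxBr !mulmxBl.
rewrite -!scalemxAl -!scalemxAr !linearB /= !linearZ /= cross -gE.
move: (\tr (C^T *m A *m C)) (\tr (g *m C)) (\tr (g *m Z^T)) => a b e h.
have -> : t / 2 * a + (2 * t)^-1 * e = b +
   (2 * t)^-1 * (t * (t * a) - t * b - (t * b - e)).
  by field; lra.
rewrite lerDl mulr_ge0//; first by rewrite invr_ge0 mulr_ge0// ltW.
by move: h; rewrite !scalerN !opprK opprB [- _ + e]addrC.
Qed.

(** Serves to average over a random sign: the cross terms of the two expansions cancel. *)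
Lemma dual_form_parallelogram k (g e : 'M[R]_(k, q)) :
  dual_form (g + e) + dual_form (g - e) = 2 * dual_form g + 2 * dual_form e.
Proof.
rewrite /dual_form linearD linearB /= !(mulmxDl, mulmxBl, mulmxDr, mulmxBr).
by rewrite !mulNmx !(mxtraceD, raddfN) /=; ring.
Qed.

Lemma dual_formZ k (g : 'M[R]_(k, q)) c : dual_form (c *: g) = c ^+ 2 * dual_form g.
Proof.
by rewrite /dual_form linearZ /= -!scalemxAl -scalemxAr !linearZ /= mulrA.
Qed.

Lemma dual_form_delta k (i : 'I_k) (y : 'rV[R]_q) :
  dual_form (delta_mx i ord0 *m y) = dual_form y.
Proof.
rewrite /dual_form trmx_mul -!mulmxA mxtrace_mulC -!mulmxA trmx_delta.
rewrite mul_delta_mx (_ : delta_mx _ _ = 1%:M) ?mulmx1//.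
by apply/matrixP => a b; rewrite !ord1 !mxE.
Qed.

(** By cyclicity of the trace, the mean is the trace of [A^-1 (A - s I)], which is q minus the
    nonnegative number s tr [A^-1]. This is how the dimension enters the bound. *)
Lemma dual_form_mean : \sum_j p j * dual_form (x j) <= q%:R.
Proof.
have -> : \sum_j p j * dual_form (x j) = \tr (invmx A *m (A - s%:M)).
  rewrite /A addrK mulmx_sumr raddf_sum; apply: eq_bigr => j _ /=.
  rewrite -scalemxAr linearZ /=; congr (_ * _).
  by rewrite /dual_form -mulmxA mxtrace_mulC mulmxA.
rewrite mulmxBr mulVmx ?moment_mx_unit// linearB /= mxtrace1 gerBl.
rewrite mul_mx_scalar linearZ /= mulr_ge0 ?(ltW s_gt0)//.
have -> : \tr (invmx A) = dual_form (1%:M : 'M[R]_q); last exact: dual_form_ge0.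
by rewrite /dual_form trmx1 mul1mx mulmx1.
Qed.

End QuadraticForms.

(** * Uniform deviations for samples over a finite alphabet *)

Section FiniteSample.
Context (R : realType) (H : Type) (h0 : H) (J : finType) (p : J -> R).
Hypotheses (p_ge0 : forall j, 0 <= p j) (p_sum : \sum_j p j = 1).
Context (f : H -> J -> R) (B1 : R).
Hypotheses (f_ge0 : forall h j, 0 <= f h j) (f_le : forall h j, f h j <= B1).
Context (q P : nat) (x : J -> 'rV[R]_q) (C : H -> 'M[R]_(q, P)) (B s : R).
Hypotheses (P_gt0 : (0 < P)%N).
Hypothesis f_lip : forall h g j,
  `|f h j - f g j| <= \sum_k `|(x j *m C h) ord0 k - (x j *m C g) ord0 k|.
Hypothesis xC_le : forall h j, \sum_k (x j *m C h) ord0 k ^+ 2 <= B ^+ 2.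
Hypothesis C_le : forall h i, \sum_k C h i k ^+ 2 <= B ^+ 2.
Hypotheses (s_gt0 : 0 < s) (sq_le1 : s * q%:R <= 1).

Definition deviation j h := \sum_i p i * f h i - f h j.

(* Symmetrized coordinate increments: j is drawn from p, the coordinate k and
   the sign uniformly; the factor P compensates for sampling one coordinate,
   and 2 comes from the ghost sample. *)
Definition rademacher_mx (z : J * 'I_P * bool) : 'M[R]_(P, q) :=
  ((-1) ^+ z.2 * (2 * P%:R)) *: (delta_mx z.1.2 ord0 *m x z.1.1).
Definition rademacher z h := \tr (rademacher_mx z *m C h).
Definition rademacher_weight (z : J * 'I_P * bool) := p z.1.1 / (2 * P%:R).

Lemma mxtrace_delta_mul (k : 'I_P) (y : 'rV[R]_q) (D : 'M[R]_(q, P)) :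
  \tr (delta_mx k ord0 *m y *m D) = (y *m D) ord0 k.
Proof.
rewrite -mulmxA mxtrace_mulC /mxtrace big_ord1 mxE (bigD1 k)//= big1 => [|i ik].
  by rewrite !mxE !eqxx mulr1 addr0.
by rewrite !mxE (negPf ik) mulr0.
Qed.

Lemma rademacherE j k e h :
  rademacher (j, k, e) h = (-1) ^+ e * (2 * P%:R) * (x j *m C h) ord0 k.
Proof.
by rewrite /rademacher /rademacher_mx /= -scalemxAl mxtraceZ mxtrace_delta_mul.
Qed.

Lemma sum_rademacher (F : J * 'I_P * bool -> R) :
  \sum_z rademacher_weight z * F z =
  \sum_j p j * ((2 * P%:R)^-1 * \sum_k (F (j, k, false) + F (j, k, true))).
Proof.
transitivity (\sum_jk \sum_e rademacher_weight (jk, e) * F (jk, e)).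
  by rewrite pair_bigA; apply: eq_bigr => -[].
transitivity (\sum_j \sum_k \sum_e rademacher_weight (j, k, e) * F (j, k, e)).
  by rewrite [RHS]pair_bigA; apply: eq_bigr => -[].
apply: eq_bigr => j _; rewrite !mulr_sumr; apply: eq_bigr => k _.
by rewrite big_bool /= /rademacher_weight /= -mulrDr mulrA [F _ + _]addrC.
Qed.

Lemma rademacher_weight_ge0 z : 0 <= rademacher_weight z.
Proof. by rewrite /rademacher_weight divr_ge0. Qed.

Lemma deviation_le i j h : deviation i h <= deviation j h + B1.
Proof.
rewrite /deviation; have := f_ge0 h i; have := f_le h j; lra.
Qed.

Lemma deviation_bounded j : bounded_above (deviation j).
Proof.
exists B1 => h; rewrite /deviation lerBlDr ler_wpDr//.
rewrite -[leRHS]mul1r -p_sum mulr_suml; apply: ler_sum => i _.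
by rewrite ler_wpM2l.
Qed.

Lemma xC_bounded h j k : `|(x j *m C h) ord0 k| <= `|B|.
Proof.
rewrite -ler_sqr ?nnegrE// !real_normK ?num_real//; apply: le_trans (xC_le h j).
by rewrite (bigD1 k)//= lerDl sumr_ge0// => i _; exact: sqr_ge0.
Qed.

Lemma rademacher_bounded z : bounded_above (rademacher z).
Proof.
case: z => [[j k] e]; exists (2 * P%:R * `|B|) => h; rewrite rademacherE.
rewrite (le_trans (ler_norm _))// !normrM normrX normrN1 expr1n mul1r.
rewrite ger0_norm// [`|P%:R|]ger0_norm// ler_wpM2l//; exact: xC_bounded.
Qed.

(** Ghost-letter argument: the mean of [f h] is taken over an independent letter i, so the objective
    is the half-sum of the mean over i of [a1 i] and of [a2 j]. Its supremum is at most the half-sum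
    of the suprema, and i and j have the same law. *)
Lemma symmetrization a : bounded_above a ->
  step p deviation (@supf R H) a <=
  \sum_j p j * (2^-1 * (supf (fun h => a h + 2 * f h j) +
                        supf (fun h => a h - 2 * f h j))).
Proof.
move=> ba.
pose a1 j h := a h + 2 * f h j; pose a2 j h := a h - 2 * f h j.
have b1 j : bounded_above (a1 j).
  case: ba => K aK; exists (K + 2 * B1) => h.
  by rewrite /a1 lerD// ler_wpM2l.
have b2 j : bounded_above (a2 j).
  by case: ba => K aK; exists K => h; rewrite /a2 lerBlDr ler_wpDr// mulr_ge0.
have H1 j : supf (a \+ deviation j) <=
    2^-1 * \sum_i p i * supf (a1 i) + 2^-1 * supf (a2 j).
  apply: supf_le => // h /=.
  have -> : a h + deviation j h = 2^-1 * \sum_i p i * a1 i h + 2^-1 * a2 j h.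
    under [X in _ * X]eq_bigr do rewrite /a1 mulrDr mulrCA.
    rewrite big_split /= -mulr_suml p_sum -mulr_sumr /deviation /a2.
    by field.
  rewrite lerD// ler_wpM2l ?invr_ge0 ?supf_ge//.
  by apply: ler_sum => i _; rewrite ler_wpM2l ?supf_ge.
rewrite /step; apply: (@le_trans _ _ (\sum_j p j *
    (2^-1 * \sum_i p i * supf (a1 i) + 2^-1 * supf (a2 j)))).
  by apply: ler_sum => j _; rewrite ler_wpM2l.
under eq_bigr do rewrite mulrDr.
under [leRHS]eq_bigr do rewrite mulrDr mulrDr.
rewrite !big_split /= -mulr_suml p_sum mul1r lerD2r mulr_sumr.
by apply: ler_sum => j _; rewrite mulrCA.
Qed.

(* Contraction: a difference of losses is at most the sum of the coordinate
   differences, and the two signs realize each absolute value. *)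
Lemma contraction a j : bounded_above a ->
  2^-1 * (supf (fun h => a h + 2 * f h j) + supf (fun h => a h - 2 * f h j)) <=
  (2 * P%:R)^-1 * \sum_k (supf (a \+ rademacher (j, k, false)) +
                          supf (a \+ rademacher (j, k, true))).
Proof.
move=> ba.
set r := _ * \sum_k _.
have P0 : 0 < P%:R :> R by rewrite ltr0n.
(* The two suprema on the left run over separate networks h and g, so it suffices to bound every
   pair. *)
have key h g : a h + 2 * f h j + (a g - 2 * f g j) <= 2 * r.
  pose y h k := (x j *m C h) ord0 k.
  apply: (@le_trans _ _ (a h + a g + 2 * \sum_k `|y h k - y g k|)).
    rewrite [leLHS](_ : _ = a h + a g + 2 * (f h j - f g j)); last by ring.
    by rewrite lerD2l ler_wpM2l// (le_trans (ler_norm _)).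
  rewrite /r mulrA invfM mulrA mulfV// mul1r ler_pdivlMl// mulrDr.
  have -> : P%:R * (a h + a g) = \sum_(k < P) (a h + a g).
    by rewrite sumr_const card_ord mulr_natl.
  rewrite !mulr_sumr -big_split; apply: ler_sum => k _ /=.
  have pos h' : (a \+ rademacher (j, k, false)) h' = a h' + 2 * P%:R * y h' k.
    by rewrite /= rademacherE expr0 mul1r.
  have neg h' : (a \+ rademacher (j, k, true)) h' = a h' - 2 * P%:R * y h' k.
    by rewrite /= rademacherE expr1 !mulNr mul1r.
  have bp : bounded_above (a \+ rademacher (j, k, false)).
    exact: bounded_aboveD (rademacher_bounded _).
  have bn : bounded_above (a \+ rademacher (j, k, true)).
    exact: bounded_aboveD (rademacher_bounded _).
  (* The network with the larger k-th coordinate goes into the supremum with the plus sign, the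
     other into the one with the minus sign. *)
  have /= [hg|gh] := leP (y g k) (y h k).
    rewrite ger0_norm ?subr_ge0//.
    apply: le_trans (lerD (supf_ge h bp) (supf_ge g bn)).
    rewrite pos neg; lra.
  rewrite ltr0_norm ?subr_lt0//.
  apply: le_trans (lerD (supf_ge g bp) (supf_ge h bn)).
  rewrite pos neg; lra.
rewrite ler_pdivrMl// -lerBrDr; apply: supf_le => // h.
rewrite lerBrDr addrC -lerBrDr; apply: supf_le => // g.
by rewrite lerBrDr addrC.
Qed.

Lemma step_deviation_le a : bounded_above a ->
  step p deviation (@supf R H) a <= step rademacher_weight rademacher (@supf R H) a.
Proof.
move=> ba; apply: le_trans (symmetrization ba) _.
rewrite /step sum_rademacher; apply: ler_sum => j _; rewrite ler_wpM2l//.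
exact: contraction.
Qed.

Let Q := dual_form p x s.

(** In Young's inequality the moment form of [C h] has two parts: a mean of squared outputs, at most
    B^2, and the ridge part, at most s q B^2 and so again at most B^2. *)
Lemma linear_supf_le (g : 'M[R]_(P, q)) t : 0 < t ->
  supf (fun h => \tr (g *m C h)) <= t * B ^+ 2 + (2 * t)^-1 * Q g.
Proof.
move=> t0; apply: supf_le => // h.
apply: le_trans (mxtrace_le_dual x p_ge0 s_gt0 _ _ t0) _; rewrite lerD2r.
have := mxtrace_moment p x s (C h)^T; rewrite trmxK => ->.
rewrite [leRHS](_ : _ = t / 2 * (B ^+ 2 + B ^+ 2)); last by field.
rewrite ler_wpM2l ?divr_ge0 ?(ltW t0)// lerD//.
  rewrite -[leRHS]mul1r -p_sum mulr_suml; apply: ler_sum => j _.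
  rewrite ler_wpM2l// (le_trans _ (xC_le h j))//.
  rewrite -trmx_mul trmxK mxtrace_mulC mxtrace_gram big_ord1.
  by [].
rewrite mxtrace_mulC mxtrace_gram.
apply: (@le_trans _ _ (s * (q%:R * B ^+ 2))).
  rewrite ler_wpM2l// ?(ltW s_gt0)//.
  rewrite mulr_natl -[q in leRHS]card_ord -sumr_const; apply: ler_sum => i _.
  exact: C_le.
by rewrite mulrA -[leRHS]mul1r ler_wpM2r ?sqr_ge0.
Qed.

(** Induction over all starting matrices g, because a step turns the functional of g into that of
    [g + rademacher_mx z]. Each step raises the mean of [Q] by at most 4 P^2 q. *)
Lemma iter_rademacher_le N (g : 'M[R]_(P, q)) t : 0 < t ->
  iter N (step rademacher_weight rademacher) (@supf R H)
    (fun h => \tr (g *m C h)) <=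
  t * B ^+ 2 + (2 * t)^-1 * (Q g + N%:R * (4 * P%:R ^+ 2 * q%:R)).
Proof.
move=> t0; elim: N g => [|N IH] g /=.
  by rewrite mul0r addr0 linear_supf_le.
have P0 : P%:R != 0 :> R by rewrite pnatr_eq0 -lt0n.
have mean : \sum_z rademacher_weight z * Q (g + rademacher_mx z) <=
    Q g + 4 * P%:R ^+ 2 * q%:R.
  rewrite sum_rademacher.
  apply: (@le_trans _ _ (\sum_j p j * (Q g + 4 * P%:R ^+ 2 * Q (x j)))).
    apply: ler_sum => j _; rewrite ler_wpM2l//.
    (* The 8 is the 2 of the parallelogram law times the square of the 2 in [rademacher_mx]. *)
    rewrite (eq_bigr (fun=> 2 * Q g + 8 * P%:R ^+ 2 * Q (x j))).
      rewrite sumr_const card_ord -mulr_natl.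
      rewrite le_eqVlt; apply/orP; left; apply/eqP; field.
      exact: P0.
    move=> k _; rewrite /rademacher_mx /= expr0 expr1 mul1r mulN1r scaleNr.
    rewrite /Q dual_form_parallelogram// dual_formZ dual_form_delta; ring.
  under eq_bigr do rewrite mulrDr mulrCA.
  rewrite big_split /= -mulr_suml p_sum mul1r lerD2l -mulr_sumr ler_wpM2l//.
  exact: dual_form_mean.
have wsum : \sum_z rademacher_weight z = 1.
  under eq_bigr do rewrite -[rademacher_weight _]mulr1.
  rewrite (sum_rademacher (fun=> 1)) -mulr_suml p_sum mul1r sumr_const card_ord.
  by rewrite -mulr_natl; field.
rewrite {1}/step.
apply: (@le_trans _ _ (\sum_z rademacher_weight z *
  (t * B ^+ 2 + (2 * t)^-1 * (Q (g + rademacher_mx z) + N%:R * (4 * P%:R ^+ 2 * q%:R))))).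
  apply: ler_sum => z _; rewrite ler_wpM2l ?rademacher_weight_ge0//.
  apply: le_trans (IH _); rewrite le_eqVlt; apply/orP; left; apply/eqP.
  congr (iter _ _ _ _); apply/funext => h.
  by rewrite /= mulmxDl mxtraceD.
under eq_bigr do rewrite mulrDr [_ * (_^-1 * _)]mulrCA mulrDr.
rewrite big_split /= -mulr_suml wsum mul1r lerD2l -mulr_sumr.
rewrite ler_wpM2l ?invr_ge0 ?mulr_ge0 ?(ltW t0)// big_split /= -mulr_suml wsum mul1r.
apply: le_trans (lerD mean (lexx _)) _; rewrite le_eqVlt; apply/orP; left; apply/eqP.
by rewrite -natr1; ring.
Qed.

Lemma mean_sup_deviation N t : 0 < t ->
  iter N (step p deviation) (@supf R H) (fun=> 0) <=
  t * B ^+ 2 + 2 * P%:R ^+ 2 * q%:R * N%:R / t.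
Proof.
move=> t0; have b0 : bounded_above (fun _ : H => 0 : R) by exists 0.
apply: le_trans (iter_step_replace N p_ge0 deviation_bounded
  rademacher_weight_ge0 rademacher_bounded step_deviation_le b0) _.
have := iter_rademacher_le N 0 t0.
have -> : (fun h => \tr (0 *m C h)) = (fun=> 0) :> (H -> R).
  by apply/funext => h; rewrite mul0mx mxtrace0.
move/le_trans; apply; rewrite lerD2l.
rewrite /Q /dual_form !mul0mx mxtrace0 add0r le_eqVlt; apply/orP; left; apply/eqP.
by field; rewrite gt_eqF.
Qed.

Lemma bad_sample_weight N t delta (bad : pred (N.-tuple J)) :
  (0 < N)%N -> 0 < t -> 0 < B1 -> 0 < delta < 1 ->
  (forall z, bad z -> exists h,
     t * B ^+ 2 + 2 * P%:R ^+ 2 * q%:R * N%:R / t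
       + Num.sqrt (8 * N%:R * ln delta^-1) * B1 <
     \sum_s deviation (tnth z s) h) ->
  \sum_(z | bad z) \prod_s p (tnth z s) <= delta.
Proof.
move=> N_gt0 t0 B1_gt0 /andP[delta0 delta1] badP.
set E := t * B ^+ 2 + _ in badP; set T := Num.sqrt _ * B1 in badP.
have N0 : 0 < N%:R :> R by rewrite ltr0n.
have L0 : 0 < ln delta^-1 by rewrite ln_gt0// invf_gt1.
(* The minimizer of [- l T + 2 N (l B1)^2]. The minimum [- T^2 / (8 N B1^2)] equals [- ln delta^-1],
   which explains the 8 in T. *)
pose l := T / (4 * N%:R * B1 ^+ 2).
have l0 : 0 <= l.
  by rewrite divr_ge0 ?mulr_ge0 ?sqrtr_ge0 ?sqr_ge0// ltW.
have T2 : T ^+ 2 = 8 * N%:R * ln delta^-1 * B1 ^+ 2.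
  by rewrite exprMn sqr_sqrtr// !mulr_ge0// ltW.
have b0 : bounded_above (fun _ : H => 0 : R) by exists 0.
have bs (z : N.-tuple J) : bounded_above (fun h => 0 + \sum_s deviation (tnth z s) h).
  have [K Kd] := choice deviation_bounded.
  by exists (\sum_s K (tnth z s)) => h; rewrite add0r ler_sum.
(* Chernoff's bound: on a bad word, the exponential of l times the excess over E + T is at least
   1. *)
apply: (@le_trans _ _ (\sum_(z : N.-tuple J) (\prod_s p (tnth z s)) *
   (expR (- (l * (E + T))) *
    expR (l * supf (fun h => 0 + \sum_s deviation (tnth z s) h))))).
  rewrite big_mkcond /=; apply: ler_sum => z _.
  have pz : 0 <= \prod_s p (tnth z s) by apply: prodr_ge0.
  case: ifPn => bz; last by rewrite !mulr_ge0 ?expR_ge0.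
  rewrite -[leLHS]mulr1 ler_wpM2l// -expRD -expR0 ler_expR addrC -mulrBr.
  have [h /ltW hz] := badP z bz.
  rewrite mulr_ge0// subr_ge0 (le_trans hz)//.
  by apply: le_trans (supf_ge h (bs z)); rewrite add0r.
under eq_bigr do rewrite mulrCA.
rewrite -mulr_sumr.
have := iter_step_sum p deviation (fun b => expR (l * supf b)) N (fun=> 0).
move=> <-.
apply: (@le_trans _ _ (expR (- (l * (E + T))) *
   expR (l * E + 2 * N%:R * (l * B1) ^+ 2))).
  rewrite ler_wpM2l ?expR_ge0//.
  apply: le_trans (exp_moment_supf h0 p_ge0 p_sum deviation_bounded deviation_le N l0 b0) _.
  by rewrite ler_expR lerD2r ler_wpM2l// mean_sup_deviation.
rewrite -expRD [X in expR X](_ : _ = - ln delta^-1).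
  by rewrite lnV ?posrE// opprK lnK.
have -> : l * B1 = T / (4 * N%:R * B1).
  by rewrite /l; field; rewrite !gt_eqF.
have -> : - (l * (E + T)) + (l * E + 2 * N%:R * (T / (4 * N%:R * B1)) ^+ 2) =
   - (T ^+ 2 / (8 * N%:R * B1 ^+ 2)).
  by rewrite /l; field; rewrite !gt_eqF.
by rewrite T2; field; rewrite !gt_eqF.
Qed.

End FiniteSample.

(** * Finite partitions of the data space *)

Section Cells.
Context (R : realType) (d : measure_display) (E : measurableType d).

Lemma measure_bigcup_fin (mu : {measure set E -> \bar R}) (J : finType)
    (A : J -> set E) :
  (forall j, measurable (A j)) -> trivIset setT A ->
  mu (\bigcup_j A j) = (\sum_j mu (A j))%E.
Proof.
move=> mA tA; rewrite measure_fin_bigcup//; last exact: finite_finset.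
have -> : [set: J] = [set` index_enum J].
  by apply/seteqP; split => j //= _; rewrite mem_index_enum.
by rewrite -fsbig_seq// index_enum_uniq.
Qed.

(** The cells are the preimages in X of the boxes of a grid of side [eta]; half-open sides make them
    disjoint. *)
Lemma grid_cells (X : set E) (D : nat) (u : 'I_D -> E -> R) (K eta : R) :
  measurable X -> (forall i, measurable_fun setT (u i)) ->
  (forall i z, X z -> `|u i z| <= K) -> 0 < eta ->
  exists (J : finType) (A : J -> set E),
    [/\ forall j, measurable (A j), trivIset setT A, \bigcup_j A j = X &
        forall j y z, A j y -> A j z -> forall i, `|u i y - u i z| <= eta].
Proof.
move=> mX mu uK eta0.
(* One slab more than the integer part of 2 K / eta, so that the endpoint K is covered too. *)
pose Q := (Num.truncn (2 * K / eta)).+1.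
pose slab (k : nat) : set R := `[- K + k%:R * eta, - K + k.+1%:R * eta[%classic.
exists {ffun 'I_D -> 'I_Q}.
exists (fun g : {ffun 'I_D -> 'I_Q} => X `&` \bigcap_(i in setT) (u i @^-1` slab (g i))); split.
- move=> g; apply: measurableI => //.
  apply: fin_bigcap_measurable => // i _.
  by rewrite -[_ @^-1` _]setTI; apply: mu => //; exact: measurable_itv.
- apply/trivIsetP => g g' _ _ gg'; apply/seteqP; split => // z.
  case=> -[_ zg] [_ zg']; case/eqP: gg'; apply/ffunP => i; apply/val_inj => /=.
  have := zg i I; have := zg' i I; rewrite /slab /= !in_itv /= => /andP[a b] /andP[a' b'].
  have lt1 (k l : nat) : - K + k%:R * eta < - K + l.+1%:R * eta -> (k <= l)%N.
    by rewrite ltrD2l ltr_pM2r// ltr_nat.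
  by apply/eqP; rewrite eqn_leq !lt1// (le_lt_trans a b', le_lt_trans a' b).
- apply/seteqP; split => [z [g _ []]//|z Xz].
  pose k i := Num.truncn ((u i z + K) / eta).
  have y0 i : 0 <= (u i z + K) / eta.
    by rewrite divr_ge0 ?(ltW eta0)//; have := uK i z Xz; rewrite ler_norml; lra.
  have kQ i : (k i < Q)%N.
    rewrite ltnS le_truncn// ler_pM2r ?invr_gt0//.
    by have := uK i z Xz; rewrite ler_norml; lra.
  exists [ffun i => Ordinal (kQ i)] => //; split => // i _.
  rewrite /slab /= ffunE /= in_itv /=.
  have /andP[] := truncn_itv (y0 i).
  rewrite ler_pdivlMr// ltr_pdivrMr// => lo hi.
  by rewrite addrC lerBlDr lo /= addrC ltrBrDr.
- move=> g y z [_ gy] [_ gz] i.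
  have := gy i I; have := gz i I; rewrite /slab /= !in_itv /= -natr1 mulrDl mul1r.
  by move=> /andP[? ?] /andP[? ?]; rewrite ler_norml; apply/andP; split; lra.
Qed.

End Cells.

(** * Independent samples as random words *)

Section IidSample.
Context (R : realType) (d d' : measure_display) (Omega : measurableType d)
  (E : measurableType d') (P : probability Omega R) (mu : probability E R).
Context (N : nat) (S : 'I_N -> {RV P >-> E}) (S_iid : iid mu S).
Context (J : finType) (A : J -> set E).
Hypotheses (mA : forall j, measurable (A j)) (tA : trivIset setT A).
Hypothesis A_full : mu (\bigcup_j A j) = 1%E.

Definition cell_weight j : R := fine (mu (A j)).

Lemma cell_weightE j : mu (A j) = (cell_weight j)%:E.
Proof. by rewrite fineK// fin_num_measure. Qed.

Lemma cell_weight_ge0 j : 0 <= cell_weight j.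
Proof. by rewrite fine_ge0. Qed.

Lemma cell_weight_sum : \sum_j cell_weight j = 1.
Proof.
apply: EFin_inj; rewrite -A_full measure_bigcup_fin// -sumEFin.
by apply: eq_bigr => j _; exact/esym/cell_weightE.
Qed.

Lemma tuple_weight_sum : \sum_(z : N.-tuple J) \prod_s cell_weight (tnth z s) = 1.
Proof.
(* The total weight is the iterated mean of the constant 1, computed with zero increments over a
   one-point class. *)
have iter1 n (a : unit -> R) :
    iter n (step cell_weight (fun _ _ => 0)) (fun=> 1) a = 1.
  elim: n a => //= n IH a; rewrite {1}/step -[RHS]cell_weight_sum.
  by apply: eq_bigr => j _; rewrite IH mulr1.
rewrite -[RHS](iter1 N (fun=> 0)) iter_step_sum.
by under [RHS]eq_bigr do rewrite mulr1.
Qed.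

(** G collects the samples whose word of cells exists and is not bad. It is a finite disjoint union
    of boxes, hence measurable, and by independence each box has the product weight of its word. *)
Lemma sample_event (delta : R) (bad : pred (N.-tuple J)) :
  \sum_(z | bad z) \prod_s cell_weight (tnth z s) <= delta ->
  exists G : set Omega,
    [/\ measurable G, ((1 - delta)%:E <= P G)%E &
        forall w, G w -> exists2 z : N.-tuple J, ~~ bad z &
          forall s, A (tnth z s) (S s w)].
Proof.
move=> bad_le.
pose box (z : N.-tuple J) := \bigcap_(s in setT) (S s @^-1` A (tnth z s)).
pose F z := if bad z then set0 else box z.
have mbox z : measurable (box z).
  apply: fin_bigcap_measurable => // s _.
  by rewrite -[_ @^-1` _]setTI; apply: measurable_funP.
have mF z : measurable (F z) by rewrite /F; case: ifP.
have tF : trivIset setT F.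
  apply/trivIsetP => y z _ _ yz; apply/seteqP; split => // w [].
  rewrite /F; case: (bad y) => //; case: (bad z) => // wy wz.
  case/eqP: yz; apply: eq_from_tnth => s.
  apply: contrapT => /eqP ne.
  have /trivIsetP/(_ (tnth y s) (tnth z s) I I ne) := tA.
  by move/seteqP => [/(_ (S s w)) + _]; apply; split; [exact: wy|exact: wz].
have Pbox z : P (box z) = (\prod_s cell_weight (tnth z s))%:E.
  have [law ind] := S_iid.
  rewrite /box ind// -prodEFin; apply: eq_bigr => s _.
  by have := law s _ (mA (tnth z s)); rewrite /distribution /pushforward => ->;
    rewrite cell_weightE.
exists (\bigcup_z F z); split.
- by apply: fin_bigcup_measurable.
- rewrite measure_bigcup_fin//.
  have -> : (\sum_z P (F z))%E =
      (\sum_(z | ~~ bad z) \prod_s cell_weight (tnth z s))%:E.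
    rewrite -sumEFin [RHS]big_mkcond /=; apply: eq_bigr => z _.
    by rewrite /F; case: (bad z) => //=; rewrite measure0.
  by rewrite lee_fin lerBlDl -[leLHS]tuple_weight_sum (bigID bad) /= lerD2r.
- move=> w [z _]; rewrite /F; case: ifPn => // bz wz; exists z => // s.
  exact: wz.
Qed.

Lemma expectation_le_cells (g : E -> R) (c : J -> R) :
  measurable_fun setT g -> (forall z, 0 <= g z) ->
  (forall j z, A j z -> g z <= c j) ->
  ('E_mu[g] <= (\sum_j cell_weight j * c j)%:E)%E.
Proof.
move=> mg g0 gc; rewrite unlock.
have mg' (D : set E) : measurable_fun D (EFin \o g).
  by apply/measurable_EFinP; exact: measurable_funS mg.
have mX : measurable (\bigcup_j A j) by apply: fin_bigcup_measurable.
have XC0 : mu (~` \bigcup_j A j) = 0%E.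
  by rewrite probability_setC// A_full subee.
rewrite (@ge0_negligible_integral _ _ _ mu _ (~` \bigcup_j A j))//; last 2 first.
- exact: measurableC.
- by move=> z _; rewrite lee_fin.
rewrite setDE setCK setTI.
have XE : \bigcup_j A j = \big[setU/set0]_(j <- index_enum J) A j.
  rewrite -bigcup_seq; congr bigcup.
  by apply/seteqP; split => j //= _; rewrite mem_index_enum.
rewrite XE ge0_integral_bigsetU//; last 3 first.
- exact: index_enum_uniq.
- exact: sub_trivIset tA.
- by move=> z _; rewrite lee_fin.
rewrite -sumEFin; apply: lee_sum => j _.
apply: (@le_trans _ _ (\int[mu]_(z in A j) (cst (c j)%:E) z)%E).
  (* Only a cell that contains a point forces [c j] to be nonnegative. *)
  have [->|/set0P[y Ay]] := eqVneq (A j) set0; first by rewrite !integral_set0.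
  apply: ge0_le_integral => //.
  - by move=> z _; rewrite lee_fin.
  - move=> z Az /=; rewrite lee_fin; exact: le_trans (gc _ _ Az).
by rewrite integral_cst// [X in (_ * X)%E](cell_weightE j) -EFinM mulrC.
Qed.
End IidSample.

(** * Uniform deviation for linear maps under a Euclidean loss *)

Section UniformDeviation.
Context (R : realType).

(** After squaring, each half follows by summing [u^2 - v^2 <= (2 |v| + |u - v|) |u - v|] over the
    entries, with |v i| at most the norm [nv] and |u i - v i| at most the sum [D]. *)
Lemma l2_norm_lip (I : finType) (a b : I -> R) :
  `|Num.sqrt (\sum_i a i ^+ 2) - Num.sqrt (\sum_i b i ^+ 2)| <=
  \sum_i `|a i - b i|.
Proof.
have half (u v : I -> R) :
    Num.sqrt (\sum_i u i ^+ 2) <= Num.sqrt (\sum_i v i ^+ 2) + \sum_i `|u i - v i|.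
  set nv := Num.sqrt (\sum_i v i ^+ 2); set D := \sum_i `|u i - v i|.
  have nv0 : 0 <= nv by exact: sqrtr_ge0.
  have sv0 : 0 <= \sum_i v i ^+ 2 by apply: sumr_ge0 => i _; exact: sqr_ge0.
  have D0 : 0 <= D by apply: sumr_ge0.
  rewrite -(ger0_norm (addr_ge0 nv0 D0)) -sqrtr_sqr ler_sqrt ?sqr_ge0//.
  have le1 i : `|v i| <= nv.
    rewrite -sqrtr_sqr ler_sqrt// (bigD1 i)//= lerDl sumr_ge0// => *.
    exact: sqr_ge0.
  have le2 i : `|u i - v i| <= D by rewrite /D (bigD1 i)//= lerDl sumr_ge0.
  rewrite sqrrD sqr_sqrtr// -addrA -lerBlDl -sumrB.
  have -> : nv * D *+ 2 + D ^+ 2 = \sum_i (2 * nv * `|u i - v i| + D * `|u i - v i|).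
    by rewrite big_split /= -!mulr_sumr -/D; ring.
  apply: ler_sum => i _; rewrite -mulrDl.
  have -> : u i ^+ 2 - v i ^+ 2 = (2 * v i + (u i - v i)) * (u i - v i) by ring.
  apply: le_trans (ler_norm _) _; rewrite normrM ler_wpM2r//.
  by rewrite (le_trans (ler_normD _ _))// lerD// normrM ger0_norm// ler_wpM2l.
rewrite ler_norml; apply/andP; split; last by rewrite lerBlDl half.
rewrite lerNl opprB lerBlDl (le_trans (half b a))// lerD2l.
by apply: ler_sum => i _; rewrite distrC.
Qed.

Context (d d' : measure_display) (Omega : measurableType d)
  (E : measurableType d') (Pr : probability Omega R) (mu : probability E R).
Context (N : nat) (S : 'I_N -> {RV Pr >-> E}) (S_iid : iid mu S).
Hypothesis N_gt0 : (0 < N)%N.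
Context (X : set E) (mX : measurable X) (X_full : mu X = 1%E).
Context (H : Type) (h0 : H) (q P : nat) (P_gt0 : (0 < P)%N).
Context (x : E -> 'rV[R]_q) (y : E -> 'rV[R]_P) (C : H -> 'M[R]_(q, P)).
Hypotheses (mx : forall i, measurable_fun setT (fun z => x z ord0 i))
  (my : forall k, measurable_fun setT (fun z => y z ord0 k)).
Context (B1 B K s : R).
Hypotheses (B1_gt0 : 0 < B1) (s_gt0 : 0 < s) (sq_le1 : s * q%:R <= 1).
Hypotheses (x_le : forall i z, X z -> `|x z ord0 i| <= K)
  (y_le : forall k z, X z -> `|y z ord0 k| <= K)
  (xC_le : forall h z, X z -> \sum_k (x z *m C h) ord0 k ^+ 2 <= B ^+ 2)
  (C_le : forall h i, \sum_k C h i k ^+ 2 <= B ^+ 2).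
Context (f : H -> E -> R) (mf : forall h, measurable_fun setT (f h)).
Hypotheses (f_ge0 : forall h z, 0 <= f h z)
  (f_le : forall h z, X z -> f h z <= B1)
  (fE : forall h z, X z ->
    f h z = Num.sqrt (\sum_k ((x z *m C h) ord0 k - y z ord0 k) ^+ 2)).

(** The modulus is the same for all h, since the entries of every [C h] are at most |B|; one
    partition thus serves the whole class. *)
Lemma linear_loss_lip h z w eps : 0 <= eps -> X z -> X w ->
  (forall i, `|x z ord0 i - x w ord0 i| <= eps) ->
  (forall k, `|y z ord0 k - y w ord0 k| <= eps) ->
  `|f h z - f h w| <= eps * (P%:R * (q%:R * `|B| + 1)).
Proof.
move=> eps0 Xz Xw xzw yzw; rewrite !fE//; apply: le_trans (l2_norm_lip _ _) _.
have -> : eps * (P%:R * (q%:R * `|B| + 1)) = \sum_(k < P) (\sum_(i < q) eps * `|B| + eps).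
  by rewrite !sumr_const !card_ord -mulr_natl -[in RHS]mulr_natl; ring.
apply: ler_sum => k _.
rewrite [X in `|X|](_ : _ = ((x z *m C h) ord0 k - (x w *m C h) ord0 k) -
  (y z ord0 k - y w ord0 k)); last by ring.
rewrite (le_trans (ler_normB _ _))// lerD//.
rewrite !mxE -sumrB (le_trans (ler_norm_sum _ _ _))//; apply: ler_sum => i _.
rewrite -mulrBl normrM ler_pM//.
rewrite -ler_sqr ?nnegrE// !real_normK ?num_real//; apply: le_trans (C_le h i).
by rewrite (bigD1 k)//= lerDl sumr_ge0// => *; exact: sqr_ge0.
Qed.

Lemma uniform_deviation (t eta delta : R) :
  0 < t -> 0 < eta -> 0 < delta < 1 ->
  exists G : set Omega,
    [/\ measurable G, ((1 - delta)%:E <= Pr G)%E &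
      forall w, G w -> forall h,
        ('E_mu[f h] <= (N%:R^-1 * (\sum_(s < N) f h (S s w)) +
           N%:R^-1 * (t * B ^+ 2 + 2 * P%:R ^+ 2 * q%:R * N%:R / t
             + Num.sqrt (8 * N%:R * ln delta^-1) * B1) + eta)%:E)%E].
Proof.
move=> t0 eta0 delta01.
have N0 : 0 < N%:R :> R by rewrite ltr0n.
pose L : R := P%:R * (q%:R * `|B| + 1).
have L0 : 0 < L by rewrite mulr_gt0 ?ltr0n// ltr_wpDl// mulr_ge0.
pose u (i : 'I_(q + P)) z : R :=
  match fintype.split i with inl a => x z ord0 a | inr k => y z ord0 k end.
have mu_u i : measurable_fun setT (u i) by rewrite /u; case: fintype.split.
have u_le i z : X z -> `|u i z| <= K by rewrite /u; case: fintype.split => ? ?; auto.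
(* With this mesh every loss varies by at most eta / 2 on a cell. The error is paid twice, for the
   mean and for the sample. *)
have eps0 : 0 < eta / 2 / L by rewrite !divr_gt0.
have [J [A [mA tA AX Aeps]]] := grid_cells mX mu_u u_le eps0.
have A_full : mu (\bigcup_j A j) = 1%E by rewrite AX.
have subX j z : A j z -> X z by move=> Ajz; rewrite -AX; exists j.
have [z0 Xz0] : X !=set0.
  apply/set0P/eqP => X0; move: X_full; rewrite X0 measure0 => /eqP.
  by rewrite eq_sym onee_eq0.
(* Empty cells also get a representative in X, so that the bounds on losses and outputs hold at
   every letter. *)
have [rep repP] : {rep : J -> E & forall j, X (rep j) /\ (forall z, A j z -> A j (rep j))}.
  apply: (@choice _ _ (fun j v => X v /\ (forall z, A j z -> A j v))) => j.
  have [Aj0|/set0P[v Av]] := eqVneq (A j) set0.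
    by exists z0; split => // z; rewrite Aj0.
  by exists v; split => //; exact: subX Av.
pose p := cell_weight mu A.
have p0 : forall j, 0 <= p j := cell_weight_ge0 mu A.
have p1 : \sum_j p j = 1 := cell_weight_sum mA tA A_full.
pose g h j := f h (rep j).
have g_lip h h' j : `|g h j - g h' j| <=
    \sum_k `|(x (rep j) *m C h) ord0 k - (x (rep j) *m C h') ord0 k|.
  rewrite /g !fE; [|exact: (repP j).1..].
  apply: le_trans (l2_norm_lip _ _) _; apply: ler_sum => k _.
  by rewrite opprB addrA subrK.
have near h j z : A j z -> `|f h z - g h j| <= eta / 2.
  move=> Ajz; have Ajr := (repP j).2 z Ajz.
  have close := Aeps j z (rep j) Ajz Ajr.
  apply: le_trans (@linear_loss_lip h z (rep j) (eta / 2 / L) _ _ _ _ _) _.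
  - exact: ltW.
  - exact: subX Ajz.
  - exact: (repP j).1.
  - by move=> i; have := close (lshift P i); rewrite /u (unsplitK (inl i)).
  - by move=> k; have := close (rshift q k); rewrite /u (unsplitK (inr k)).
  - by rewrite -/L divfK ?gt_eqF.
set bound := t * _ + _ + _.
pose bad (z : N.-tuple J) :=
  `[< exists h, bound < \sum_s deviation p g (tnth z s) h >].
have bad_le : \sum_(z | bad z) \prod_s p (tnth z s) <= delta.
  apply: (bad_sample_weight h0 p0 p1 _ _ P_gt0 g_lip _ C_le s_gt0 sq_le1 N_gt0 t0
    B1_gt0 delta01) => //.
  - by move=> h j; exact: f_ge0.
  - by move=> h j; apply: f_le; exact: (repP j).1.
  - by move=> h j; apply: xC_le; exact: (repP j).1.
  - by move=> z /asboolP.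
have [G [mG PG GP]] := sample_event S_iid mA tA A_full bad_le.
exists G; split => // w Gw h; have [z nbad zS] := GP w Gw.
have E_le : ('E_mu[f h] <= (\sum_j p j * (g h j + eta / 2))%:E)%E.
  apply: expectation_le_cells => // j v Av.
  by have := near h j v Av; rewrite ler_norml; lra.
apply: le_trans E_le _; rewrite lee_fin.
under eq_bigr do rewrite mulrDr.
rewrite big_split /= -mulr_suml p1 mul1r.
have {nbad} : \sum_s deviation p g (tnth z s) h <= bound.
  by rewrite leNgt; apply: contra nbad => lt; apply/asboolP; exists h.
rewrite /deviation sumrB sumr_const card_ord -[_ *+ N]mulr_natl.
set m := \sum_j _ * _ => dev.
have emp : \sum_(i < N) g h (tnth z i) <= \sum_(i < N) f h (S i w) + N%:R * (eta / 2).
  rewrite -[N in N%:R * _]card_ord mulr_natl -sumr_const -big_split /=.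
  apply: ler_sum => i _.
  by have := near h _ _ (zS i); rewrite ler_norml; lra.
rewrite [leRHS](_ : _ = N%:R^-1 *
   (\sum_(i < N) f h (S i w) + bound + N%:R * (eta / 2)) + eta / 2); last first.
  by field; rewrite gt_eqF.
rewrite lerD2r ler_pdivlMl//; lra.
Qed.

End UniformDeviation.

(** * Frobenius norms, operator norms and real coordinates *)

Section Frobenius.
Context (R : realType).

Lemma frobenius_mxvec m n (A : 'M[R]_(m, n)) :
  frobenius A = Num.sqrt (\sum_k mxvec A ord0 k ^+ 2).
Proof.
rewrite /frobenius; congr Num.sqrt; rewrite pair_bigA /=.
rewrite [RHS](reindex _ (curry_mxvec_bij _ _)) /=.
by apply: eq_bigr => -[i j] _; rewrite mxvecE.
Qed.

Lemma frobenius_sqr m n (A : 'M[R]_(m, n)) :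
  frobenius A ^+ 2 = \sum_k mxvec A ord0 k ^+ 2.
Proof.
by rewrite frobenius_mxvec sqr_sqrtr// sumr_ge0// => *; exact: sqr_ge0.
Qed.

Lemma frobenius_ge0 m n (A : 'M[R]_(m, n)) : 0 <= frobenius A.
Proof. exact: sqrtr_ge0. Qed.

Lemma frobeniusZ m n c (A : 'M[R]_(m, n)) : frobenius (c *: A) = `|c| * frobenius A.
Proof.
rewrite !frobenius_mxvec -sqrtr_sqr -sqrtrM ?sqr_ge0// mulr_sumr; congr Num.sqrt.
by apply: eq_bigr => k _; rewrite linearZ mxE exprMn.
Qed.

Lemma frobenius0 m n : frobenius (0 : 'M[R]_(m, n)) = 0.
Proof. by rewrite -(scale0r 0) frobeniusZ normr0 mul0r. Qed.

Lemma mxvec_le_frobenius m n (A : 'M[R]_(m, n)) k : `|mxvec A ord0 k| <= frobenius A.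
Proof.
rewrite -ler_sqr ?nnegrE ?frobenius_ge0// frobenius_sqr real_normK ?num_real//.
by rewrite (bigD1 k)//= lerDl sumr_ge0// => *; exact: sqr_ge0.
Qed.

Lemma frobenius_eq0 m n (A : 'M[R]_(m, n)) : frobenius A = 0 -> A = 0.
Proof.
move=> A0; apply: (can_inj mxvecK); apply/rowP => k; rewrite linear0 mxE.
by apply/eqP; rewrite -normr_le0 -A0 mxvec_le_frobenius.
Qed.

Lemma frobenius_le_sum m n (A : 'M[R]_(m, n)) :
  frobenius A <= \sum_k `|mxvec A ord0 k|.
Proof.
have := l2_norm_lip (fun k => mxvec A ord0 k) (fun=> 0).
rewrite [X in _ - Num.sqrt X]big1 => [|k _]; last by rewrite expr0n.
under [X in _ <= X -> _]eq_bigr do rewrite subr0.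
by rewrite sqrtr0 subr0 -frobenius_mxvec ger0_norm ?frobenius_ge0.
Qed.

(** For positive norms a and b, each entry satisfies [(x - y)^2 <= (a + b) / a * x^2 + (a + b) / b *
    y^2], the gap being [(b x + a y)^2 / (a b)]; the right sides add up to (a + b)^2. *)
Lemma frobeniusB_le m n (A B : 'M[R]_(m, n)) :
  frobenius (A - B) <= frobenius A + frobenius B.
Proof.
set a := frobenius A; set b := frobenius B.
have [a0|an0] := eqVneq a 0.
  by rewrite a0 (frobenius_eq0 a0) sub0r -scaleN1r frobeniusZ normrN1 mul1r add0r.
have [b0|bn0] := eqVneq b 0.
  by rewrite b0 (frobenius_eq0 b0) subr0 addr0.
have ap : 0 < a by rewrite lt_def an0 frobenius_ge0.
have bp : 0 < b by rewrite lt_def bn0 frobenius_ge0.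
rewrite -ler_sqr ?nnegrE ?frobenius_ge0 ?addr_ge0 ?frobenius_ge0//.
rewrite frobenius_sqr.
have -> : (a + b) ^+ 2 = (a + b) / a * a ^+ 2 + (a + b) / b * b ^+ 2.
  by field; rewrite an0 bn0.
rewrite [a ^+ 2 in leRHS]frobenius_sqr [b ^+ 2 in leRHS]frobenius_sqr.
rewrite !mulr_sumr -big_split /=; apply: ler_sum => k _.
rewrite linearB !mxE; move: (mxvec A ord0 k) (mxvec B ord0 k) => x y.
rewrite -subr_ge0 (_ : _ - _ = (b * x + a * y) ^+ 2 / (a * b)).
  by rewrite divr_ge0 ?sqr_ge0// mulr_ge0 ?frobenius_ge0.
by field; rewrite an0 bn0.
Qed.

(** Scaled to norm 1, X enters the family that defines [op_norm]. The entries of [lin_mx f] bound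
    this family, so its [sup] is a genuine upper bound. *)
Lemma frobenius_linear_le m n p q
    (f : {linear 'M[R]_(m, n) -> 'M[R]_(p, q)}) (X : 'M[R]_(m, n)) :
  frobenius (f X) <= op_norm f * frobenius X.
Proof.
have [X0|Xn0] := eqVneq (frobenius X) 0.
  by rewrite (frobenius_eq0 X0) linear0 !frobenius0 mulr0.
have Xp : 0 < frobenius X by rewrite lt_def Xn0 frobenius_ge0.
rewrite -ler_pdivrMr// mulrC -[(frobenius X)^-1]ger0_norm ?invr_ge0 ?frobenius_ge0//.
rewrite -frobeniusZ -linearZ; apply: ub_le_sup; last first.
  exists ((frobenius X)^-1 *: X) => //=.
  by rewrite frobeniusZ ger0_norm ?invr_ge0 ?frobenius_ge0// mulVf.
exists (\sum_k \sum_i `|lin_mx f i k|) => _ [Y /= Y1 <-].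
apply: le_trans (frobenius_le_sum _) _; apply: ler_sum => k _.
rewrite -mul_vec_lin mxE (le_trans (ler_norm_sum _ _ _))//; apply: ler_sum => i _.
rewrite normrM -[leRHS]mul1r ler_wpM2r//.
exact: le_trans (mxvec_le_frobenius _ _) Y1.
Qed.

Lemma frobenius_Re_le m n (A : 'M[R[i]]_(m, n)) :
  frobenius (map_mx (@complex.Re R) A) <= frobeniusC A.
Proof.
rewrite ler_sqrt; last by do 2!apply: sumr_ge0 => ? _; exact: sqr_ge0.
do 2!apply: ler_sum => ? _; rewrite mxE; case: (A _ _) => a b /=.
by rewrite sqr_sqrtr ?addr_ge0 ?sqr_ge0// lerDl sqr_ge0.
Qed.

Lemma frobenius_Im_le m n (A : 'M[R[i]]_(m, n)) :
  frobenius (map_mx (@complex.Im R) A) <= frobeniusC A.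
Proof.
rewrite ler_sqrt; last by do 2!apply: sumr_ge0 => ? _; exact: sqr_ge0.
do 2!apply: ler_sum => ? _; rewrite mxE; case: (A _ _) => a b /=.
by rewrite sqr_sqrtr ?addr_ge0 ?sqr_ge0// lerDr sqr_ge0.
Qed.

(** Real coordinates are used because taking real parts leaves the networks linear over the reals
    only. *)
Definition real_coords m n (A : 'M[R[i]]_(m, n)) : 'rV[R]_(m * n + m * n) :=
  row_mx (mxvec (map_mx (@complex.Re R) A)) (mxvec (map_mx (@complex.Im R) A)).

Definition of_real_coords m n (v : 'rV[R]_(m * n + m * n)) : 'M[R[i]]_(m, n) :=
  \matrix_(i, j) Complex (vec_mx (lsubmx v) i j) (vec_mx (rsubmx v) i j).

Lemma real_coordsK m n : cancel (@real_coords m n) (@of_real_coords m n).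
Proof.
move=> A; apply/matrixP => i j; rewrite mxE row_mxKl row_mxKr !mxvecK !mxE.
by case: (A i j).
Qed.

Lemma of_real_coordsD m n c (v w : 'rV[R]_(m * n + m * n)) :
  of_real_coords (c *: v + w) =
  (Complex c 0) *: of_real_coords v + of_real_coords w.
Proof.
apply/matrixP => i j; rewrite !mxE.
by rewrite /GRing.mul /GRing.add /= !mul0r subr0 addr0.
Qed.

Lemma real_coords_le m n (A : 'M[R[i]]_(m, n)) k :
  `|real_coords A ord0 k| <= frobeniusC A.
Proof.
rewrite mxE; case: fintype.splitP => j _.
  exact: le_trans (mxvec_le_frobenius _ _) (frobenius_Re_le A).
exact: le_trans (mxvec_le_frobenius _ _) (frobenius_Im_le A).
Qed.

End Frobenius.

(** Take a free family in X of maximal length: a vector of X outside its span could be added. The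
    rows are themselves members of X, so bounds valid on X apply to them. *)
Lemma spanning_family (F : fieldType) (m : nat) (X : set 'rV[F]_m) :
  exists q (W : 'M[F]_(q, m)),
    [/\ (q <= m)%N, forall i, X (row i W) & forall v, X v -> (v <= W)%MS].
Proof.
pose good q := `[< exists W : 'M[F]_(q, m), row_free W /\ forall i, X (row i W) >].
have good0 : exists q, good q.
  exists 0%N; apply/asboolP; exists 0; split; last by case.
  by rewrite /row_free mxrank0.
have good_le q : good q -> (q <= m)%N.
  by move=> /asboolP[W [/eqP Wq _]]; have := rank_leq_col W; rewrite Wq.
have [q /asboolP[W [Wfree WX]] maxq] := ex_maxnP good0 good_le.
exists q, W; split => //; first by apply: good_le; apply/asboolP; exists W.
move=> v Xv; apply/negPn/negP => vW.
suff /maxq : good (1 + q)%N by rewrite add1n ltnn.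
apply/asboolP; exists (col_mx v W); split; last first.
  move=> a; rewrite -[a]splitK; case: (fintype.split a) => k /=.
    by rewrite rowKu ord1 row_id.
  by rewrite rowKd.
rewrite /row_free eqn_leq rank_leq_row -addsmxE add1n -[q in (q < _)%N](eqP Wfree).
by rewrite rank_ltmx// ltmxE addsmxSr addsmx_sub negb_and vW.
Qed.

(** * Networks as real-linear maps of the data *)

Section Networks.
Context (R : realType).

Section Linearity.
Context (n nrho k : nat) (w1 w2 : R) (U : 'M[R[i]]_(n, k)) (M : 'M[R[i]]_k)
  (V : 'M[R[i]]_(k, nrho)) (D : 'M[R[i]]_n).

Lemma shift_mx_linear m (c : R[i]) (L L' : 'M[R[i]]_n) :
  shift_mx m (c *: L + L') = c *: shift_mx m L + shift_mx m L'.
Proof. by apply/matrixP => a b; rewrite !mxE. Qed.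

Lemma diag_row_linear l (c : R[i]) (L L' : 'M[R[i]]_l) :
  diag_row (c *: L + L') = c *: diag_row L + diag_row L'.
Proof. by apply/rowP => b; rewrite !mxE. Qed.

Lemma phi11_linear w (c : R[i]) (L L' : 'M[R[i]]_n) :
  phi11 U M V D w (c *: L + L') = c *: phi11 U M V D w L + phi11 U M V D w L'.
Proof.
rewrite /phi11 !(mulmxDr, mulmxDl, =^~ scalemxAr, =^~ scalemxAl).
rewrite addrACA -scalerDr diag_row_linear scalerDr !scalerA.
by rewrite [_ * c]mulrC.
Qed.

Lemma phi12_linear w (c : R[i]) (L L' : 'M[R[i]]_n) :
  phi12 U M V w (c *: L + L') = c *: phi12 U M V w L + phi12 U M V w L'.
Proof.
rewrite /phi12 !(mulmxDr, mulmxDl, =^~ scalemxAr, =^~ scalemxAl).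
by rewrite diag_row_linear scalerDr !scalerA [_ * c]mulrC.
Qed.

Lemma rows_linear p q (f g h : 'I_p -> 'rV[R[i]]_q) (c : R[i]) :
  (forall i, f i = c *: g i + h i) ->
  \matrix_i f i = c *: \matrix_i g i + \matrix_i h i.
Proof. by move=> fE; apply/matrixP => a b; rewrite !mxE fE !mxE. Qed.

Lemma sandwich_linear p q l (A B : 'M[R[i]]_(p, q)) (C : 'M[R[i]]_(l, n))
    (c : R[i]) (X X' X'' Y Y' Y'' : 'M[R[i]]_(q, l)) :
  X = c *: X' + X'' -> Y = c *: Y' + Y'' ->
  A *m X *m C + B *m Y *m C =
  c *: (A *m X' *m C + B *m Y' *m C) + (A *m X'' *m C + B *m Y'' *m C).
Proof.
move=> -> ->; rewrite !(mulmxDr, mulmxDl, =^~ scalemxAr, =^~ scalemxAl).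
by rewrite addrACA -scalerDr.
Qed.

Lemma bfnn_term_linear w (c : R[i]) (L L' : 'M[R[i]]_n) :
  bfnn_term w1 U M V D w (c *: L + L') =
  c *: bfnn_term w1 U M V D w L + bfnn_term w1 U M V D w L'.
Proof.
apply: sandwich_linear; apply: rows_linear => m.
  by rewrite shift_mx_linear phi11_linear.
by rewrite shift_mx_linear phi12_linear.
Qed.

Lemma bfnn_linear (c : R[i]) (L L' : 'M[R[i]]_(n + n, n)) :
  bfnn w1 w2 U M V D (c *: L + L') =
  c *: bfnn w1 w2 U M V D L + bfnn w1 w2 U M V D L'.
Proof.
have lin (up : bool) (X Y : 'M[R[i]]_(n + n, n)) :
    (if up then usubmx (c *: X + Y) else dsubmx (c *: X + Y)) =
    c *: (if up then usubmx X else dsubmx X) + (if up then usubmx Y else dsubmx Y).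
  by case: up; apply/matrixP => a b; rewrite !mxE.
rewrite /bfnn (lin true) (lin false) /= !bfnn_term_linear.
by rewrite addrACA -scalerDr.
Qed.

End Linearity.

Lemma map_Re_linear m n c (A B : 'M[R[i]]_(m, n)) :
  map_mx (@complex.Re R) (Complex c 0 *: A + B) =
  c *: map_mx (@complex.Re R) A + map_mx (@complex.Re R) B.
Proof.
apply/matrixP => a b; rewrite !mxE /GRing.mul /GRing.add /=.
by case: (A a b) => ? ?; case: (B a b) => ? ? /=; rewrite mul0r subr0.
Qed.

Section NetworkClass.
Context (n nrho nr r : nat) (w1 w2 alpha BU BM BV BD : R).
Local Notation Hnet := (@H_net R n nrho nr r w1 w2 alpha BU BM BV BD).
Local Notation Hbfnn := (@H_BFNN R n nrho nr r w1 w2 BU BM BV BD).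

(** [bfnn] is complex-linear in the data, while the real part, [psi0] and [psi] are real-linear; the
    rows of T are the images of the coordinate vectors. *)
Lemma H_net_matrix h : Hnet h ->
  exists T : 'M[R]_((n + n) * n + (n + n) * n, (n + n) * n),
    forall L, mxvec (h L) = real_coords L *m T.
Proof.
move=> [psi [psi0 [phi [U [M [V [D [_ _ ->]]]]] [_ _ ->]]]].
pose f (v : 'rV[R]_((n + n) * n + (n + n) * n)) : 'rV[R]_((n + n) * n) :=
  mxvec (psi (psi0 (map_mx (@complex.Re R) (bfnn w1 w2 U M V D (of_real_coords v))))).
have f_lin c v w : f (c *: v + w) = c *: f v + f w.
  rewrite /f of_real_coordsD bfnn_linear map_Re_linear.
  by rewrite (linearP psi0) (linearP psi) linearD /= linearZ.
exists (\matrix_k f (delta_mx ord0 k)) => L.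
have f0 : f 0 = 0.
  by have := f_lin (-1) 0 0; rewrite scaler0 addr0 scaleN1r addNr.
rewrite -{1}[L]real_coordsK -/(f _); move: (real_coords L) => v.
rewrite mulmx_sum_row [v in f v]row_sum_delta.
under [RHS]eq_bigr do rewrite rowK.
elim: (index_enum _) => [|k s IH]; first by rewrite !big_nil.
by rewrite !big_cons f_lin IH.
Qed.

Lemma H_net_le h phiB L : Hnet h -> 0 < alpha ->
  (forall phi, Hbfnn phi -> frobeniusC (phi L) <= phiB) ->
  frobenius (h L) <= 4 * phiB / alpha.
Proof.
move=> [psi [psi0 [phi Hphi [psi_le psi0_le ->]]]] alpha0 phi_le.
have := phi_le _ Hphi; set A := phi L => A_le.
have Re_le := le_trans (frobenius_Re_le A) A_le.
apply: le_trans (frobenius_linear_le _ _) _.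
apply: (@le_trans _ _ (2 * alpha^-1 * (2 * phiB))).
  apply: le_trans (ler_wpM2r (frobenius_ge0 _) psi_le) _.
  rewrite ler_wpM2l ?mulr_ge0 ?invr_ge0 ?(ltW alpha0)//.
  apply: le_trans (frobenius_linear_le _ _) _.
  apply: le_trans (ler_wpM2r (frobenius_ge0 _) psi0_le) _.
  by rewrite ler_wpM2l.
rewrite le_eqVlt; apply/orP; left; apply/eqP; field.
by rewrite gt_eqF.
Qed.

End NetworkClass.

(** * Measurability of coordinates and sets of full measure *)

Section Measurability.
Context (n : nat).

Lemma measurable_real_coords k :
  measurable_fun setT (fun L : inputs R n => real_coords (L : 'M[R[i]]_(n + n, n)) ord0 k).
Proof.
have gen (B : set R) (part : R[i] -> R) i j :
    measurable B -> part = @complex.Re R \/ part = @complex.Im R ->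
    measurable [set L : inputs R n | B (part ((L : 'M[R[i]]_(n + n, n)) i j))].
  move=> mB partE; apply: sub_sigma_algebra; exists i, j, B => //.
  by case: partE => ->; [left|right].
move=> _ B mB; rewrite setTI.
rewrite -[k]splitK; case: (fintype.split k) => l /=;
  case/mxvec_indexP: l => i j.
  rewrite (_ : _ @^-1` _ = [set L : inputs R n | B (complex.Re (L i j))]); last first.
    by apply/seteqP; split => L /=; rewrite row_mxEl mxvecE mxE.
  by apply: gen => //; left.
rewrite (_ : _ @^-1` _ = [set L : inputs R n | B (complex.Im (L i j))]); last first.
  by apply/seteqP; split => L /=; rewrite row_mxEr mxvecE mxE.
by apply: gen => //; right.
Qed.

Lemma measurable_target_coords k :
  measurable_fun setT (fun Y : targets R n => mxvec (Y : 'M[R]_(n + n, n)) ord0 k).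
Proof.
move=> _ B mB; rewrite setTI; case/mxvec_indexP: k => i j.
apply: sub_sigma_algebra; exists i, j, B => //.
by apply/seteqP; split => Y /=; rewrite mxvecE.
Qed.

Lemma measurable_fun_mulmx d (T : measurableType d) p q (x : T -> 'rV[R]_p)
    (A : 'M[R]_(p, q)) k :
  (forall i, measurable_fun setT (fun z => x z ord0 i)) ->
  measurable_fun setT (fun z => (x z *m A) ord0 k).
Proof.
move=> mx; under eq_fun do rewrite mxE.
apply: measurable_sum => i; apply: measurable_funM => //.
Qed.

End Measurability.

Lemma ae_full_set d (T : measurableType d) (mu : probability T R) (Q : T -> Prop) :
  {ae mu, forall z, Q z} ->
  exists X, [/\ measurable X, mu X = 1%E & forall z, X z -> Q z].
Proof.
move=> [Z [mZ muZ QZ]]; exists (~` Z); split; first exact: measurableC.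
- by rewrite probability_setC// muZ sube0.
- by move=> z Zz; apply: contrapT => nQ; apply: Zz; exact: QZ.
Qed.

End Networks.

(** * Numerical constants of the bound *)

Lemma deviation_rate (R : realType) (Bout B1 alpha c delta B t : R) (n N q : nat) :
  0 < Bout -> 0 < B1 -> 0 < alpha -> 0 <= c -> (0 < n)%N -> (0 < N)%N ->
  (q <= (n + n) * n + (n + n) * n)%N -> 0 < delta < 1 ->
  B = 4 * Bout / alpha -> t = 4 * n%:R ^+ 3 * Num.sqrt N%:R / B ->
  N%:R^-1 * (t * B ^+ 2 + 2 * ((n + n) * n)%:R ^+ 2 * q%:R * N%:R / t
     + Num.sqrt (8 * N%:R * ln delta^-1) * B1)
   + Bout * alpha^-1 * n%:R ^+ 3 * N%:R `^ (- 2^-1) <=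
  2 ^+ 2 * (Num.sqrt (2 * ln (4 * delta^-1)) * B1
     + 2 ^+ 6 * 3 * Num.sqrt 2 * Bout * alpha^-1 * (1 + c) `^ (2^-1) * n%:R ^+ 3)
  * N%:R `^ (- 2^-1).
Proof.
move=> Bout0 B10 alpha0 c0 n0 N0 q_le /andP[delta0 delta1] BE tE.
have nR : 0 < n%:R :> R by rewrite ltr0n.
have NR : 0 < N%:R :> R by rewrite ltr0n.
set e := Num.sqrt N%:R in tE *.
have e0 : 0 < e by rewrite sqrtr_gt0.
have Ne : N%:R = e ^+ 2 :> R by rewrite sqr_sqrtr// ltW.
have B0 : 0 < B by rewrite BE divr_gt0// mulr_gt0.
have rho : N%:R `^ (- 2^-1) = e^-1 by rewrite powRN powR12_sqrt// ltW.
pose X := Bout * alpha^-1 * n%:R ^+ 3.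
have X0 : 0 < X by rewrite !mulr_gt0 ?invr_gt0 ?exprn_gt0.
have BX : B * n%:R ^+ 3 = 4 * X by rewrite BE /X; field; rewrite gt_eqF.
have ln0 : 0 < ln delta^-1 by rewrite ln_gt0// invf_gt1.
have q_leR : q%:R <= 4 * n%:R ^+ 2 :> R.
  apply: (@le_trans _ _ ((n + n) * n + (n + n) * n)%:R); first by rewrite ler_nat.
  by rewrite !(natrD, natrM) le_eqVlt; apply/orP; left; apply/eqP; ring.
have t0 : 0 < t by rewrite tE divr_gt0// !mulr_gt0// exprn_gt0.
(* With this t the two terms are at most 4 and 8 times [B n^3 sqrt N], and [B n^3] is 4 X. *)
have capacity : t * B ^+ 2 + 2 * ((n + n) * n)%:R ^+ 2 * q%:R * N%:R / t <= 48 * X * e.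
  apply: (@le_trans _ _ (t * B ^+ 2 +
      2 * ((n + n) * n)%:R ^+ 2 * (4 * n%:R ^+ 2) * N%:R / t)).
    rewrite lerD2l ler_pM2r ?invr_gt0// ler_pM2r// ler_wpM2l//.
  have -> : 48 * X * e = 12 * (B * n%:R ^+ 3) * e by rewrite BX; ring.
  rewrite le_eqVlt; apply/orP; left; apply/eqP.
  rewrite natrM natrD Ne tE; field.
  by rewrite !gt_eqF.
have confidence : Num.sqrt (8 * N%:R * ln delta^-1) <=
    4 * e * Num.sqrt (2 * ln (4 * delta^-1)).
  have l4 : ln delta^-1 <= ln (4 * delta^-1).
    rewrite ler_ln ?posrE ?mulr_gt0 ?invr_gt0//.
    by rewrite ler_peMl ?invr_ge0 ?(ltW delta0)//; lra.
  have -> : 4 * e * Num.sqrt (2 * ln (4 * delta^-1)) =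
      Num.sqrt (16 * N%:R * (2 * ln (4 * delta^-1))).
    rewrite [RHS]sqrtrM ?mulr_ge0 ?(ltW NR)// [Num.sqrt (16 * _)]sqrtrM//.
    congr (_ * _ * _).
    by rewrite (_ : 16 = 4 ^+ 2) ?sqrtr_sqr ?ger0_norm//; ring.
  have := mulr_gt0 NR ln0; move: (ler_wpM2l (ltW NR) l4) => h1 h2.
  rewrite ler_sqrt; nra.
have pow1 : 1 <= (1 + c) `^ 2^-1.
  by rewrite powR12_sqrt ?addr_ge0// -[leLHS]sqrtr1 ler_sqrt ?addr_ge0// lerDl.
have sqrt2 : 1 <= Num.sqrt 2 :> R by rewrite -[leLHS]sqrtr1 ler_sqrt//; lra.
rewrite rho -/X.
have -> : 2 ^+ 6 * 3 * Num.sqrt 2 * Bout * alpha^-1 * (1 + c) `^ (2^-1) * n%:R ^+ 3 =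
   192 * X * (Num.sqrt 2 * (1 + c) `^ (2^-1)) by rewrite /X; ring.
rewrite ler_pdivlMr// mulrDl mulfVK ?gt_eqF//.
have -> : N%:R^-1 = e^-1 * e^-1 by rewrite Ne -invfM.
set cap := t * _ + _ in capacity *; set cf := Num.sqrt _ in confidence *.
set sl := Num.sqrt (2 * ln _) in confidence *; set z := Num.sqrt 2 * _.
have z1 : 1 <= z by rewrite -[leLHS]mul1r ler_pM.
rewrite [leLHS](_ : _ = (cap + cf * B1) / e + X); last by field; rewrite gt_eqF.
have : (cap + cf * B1) / e <= 48 * X + 4 * sl * B1.
  rewrite ler_pdivrMr// mulrDl lerD//.
  apply: le_trans (ler_wpM2r (ltW B10) confidence) _.
  by rewrite le_eqVlt; apply/orP; left; apply/eqP; ring.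
(* Capacity and discretization amount to 48 X + X, against 4 * 192 X z with z at least 1. *)
have := ler_wpM2l (ltW X0) z1; lra.
Qed.

(** * Generalization bound for compressed networks *)

Theorem theorem4p2 (R : realType)
    (w1 w2 alpha Bin Btgt Bout BU BM BV BD : R) (n nrho nr r N : nat)
    (w1_gt0 : 0 < w1) (w1_lt_w2 : w1 < w2)
    (w_ratio : w2 / w1 \is a Num.nat) (alpha_gt0 : 0 < alpha)
    (Bin_gt0 : 0 < Bin) (Btgt_gt0 : 0 < Btgt) (Bout_gt0 : 0 < Bout)
    (BU_gt0 : 0 < BU) (BM_gt0 : 0 < BM) (BV_gt0 : 0 < BV) (BD_gt0 : 0 < BD)
    (n_gt0 : (0 < n)%N) (nrho_gt0 : (0 < nrho)%N)
    (nr_gt0 : (0 < nr)%N) (r_gt0 : (0 < r)%N) (N_gt0 : (0 < N)%N)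
    (n_nrho : n%:R = w1 / w2 * nrho%:R)
    (nr_dvd_n : (nr %| n)%N) (nr_dvd_nrho : (nr %| nrho)%N)
    (rank_le : w2 / w1 * (nr * r)%:R <= n%:R)
    (mu1 : probability (inputs R n) R) (mu2 : probability (targets R n) R)
    (input_le : {ae mu1, forall L, frobeniusC L <= Bin})
    (target_le : {ae mu2, forall Y, frobenius Y <= Btgt})
    (output_real : {ae mu1, forall L, forall phi,
       H_BFNN nrho nr r w1 w2 BU BM BV BD phi -> phi L \is a mxOver Num.real})
    (output_le : {ae mu1, forall L, forall h,
       H_net nrho nr r w1 w2 alpha BU BM BV BD h -> frobenius (h L) <= Bout})
    (bfnn_le : {ae mu1, forall L, forall phi,
       H_BFNN nrho nr r w1 w2 BU BM BV BD phi -> frobeniusC (phi L) <= Bout})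
    (d : measure_display) (Omega : measurableType d) (P : probability Omega R)
    (S : 'I_N -> {RV P >-> (inputs R n * targets R n)%type})
    (S_iid : iid (mu1 \x mu2)%E S)
    (delta : R) (delta_gt0 : 0 < delta) (delta_lt1 : delta < 1) :
  exists G : set Omega,
    [/\ measurable G, ((1 - delta)%:E <= P G)%E
      & forall x, G x ->
        forall h, @H_net R n nrho nr r w1 w2 alpha BU BM BV BD h ->
        (true_loss (mu1 \x mu2)%E h <=
          (empirical_loss (fun s => S s x) h
           + 2 ^+ 2
             * (Num.sqrt (2 * ln (4 * delta^-1)) * (Bout + Btgt)
                + 2 ^+ 6 * 3 * Num.sqrt 2 * Bout * alpha^-1
                  * (1 + c1_const w1 w2 BU BM BV BD Bin * Bout^-1
                         * n%:R `^ (- (3 / 2))) `^ (2^-1)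
                  * n%:R ^+ 3)
             * N%:R `^ (- 2^-1))%:E)%E].
Proof.
(* For an empty class the claim is vacuous on the whole sample space; otherwise [h0] makes the
   suprema run over a nonempty set. *)
have [[h0 h0_net]|no_h] := pselect
    (exists h, @H_net R n nrho nr r w1 w2 alpha BU BM BV BD h); last first.
  exists setT; split => //; first by rewrite probability_setT lee_fin lerBlDr lerDl ltW.
  by move=> x _ h h_net; case: no_h; exists h.
have [X1 [mX1 X1_full X1P]] : exists X1 : set (inputs R n),
    [/\ measurable X1, mu1 X1 = 1%E & forall L, X1 L -> [/\ frobeniusC L <= Bin,
      forall h, @H_net R n nrho nr r w1 w2 alpha BU BM BV BD h -> frobenius (h L) <= Bout &
      forall phi, @H_BFNN R n nrho nr r w1 w2 BU BM BV BD phi -> frobeniusC (phi L) <= Bout]].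
  apply: ae_full_set; move: input_le output_le bfnn_le.
  apply: filterS3; first exact: (ae_filter_ringOfSetsType mu1).
  by move=> L; split.
have [X2 [mX2 X2_full X2P]] := ae_full_set target_le.
pose E := (inputs R n * targets R n)%type.
pose mu : probability E R := (mu1 \x mu2)%E.
pose X : set E := X1 `*` X2.
have mX : measurable X by exact: measurableX.
have X_full : mu X = 1%E.
  transitivity (mu1 X1 * mu2 X2)%E; first exact: product_measure1E.
  by rewrite X1_full X2_full mule1.
pose H := {h | @H_net R n nrho nr r w1 w2 alpha BU BM BV BD h}.
pose B := 4 * Bout / alpha.
have h_le (h : H) L : X1 L -> frobenius (sval h L) <= B.
  move=> /X1P[_ _ L_le]; exact: (H_net_le (svalP h) alpha_gt0 L_le).
have [T TE] := choice (fun h : H => H_net_matrix (svalP h)).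
(* The data are expanded in a spanning family W of data points, with coefficients given by
   [pinvmx W]. The rows of [C h] are then outputs of h at such points, hence of norm at most B. *)
have [q [W [q_le W_X W_span]]] := spanning_family (@real_coords R (n + n) n @` X1).
pose x (z : E) := real_coords z.1 *m pinvmx W.
pose C (h : H) := W *m T h.
have xC h z : X z -> x z *m C h = mxvec (sval h z.1).
  move=> [Xz _]; rewrite /x /C mulmxA mulmxKpV -?TE//.
  by apply: W_span; exists z.1.
have sum_mxvec p1 p2 (A : 'M[R]_(p1, p2)) c : frobenius A <= c ->
    \sum_k mxvec A ord0 k ^+ 2 <= c ^+ 2.
  by move=> Ac; rewrite -frobenius_sqr lerXn2r ?nnegrE ?(le_trans _ Ac) ?frobenius_ge0.
pose m := ((n + n) * n + (n + n) * n)%N.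
have m_gt0 : (0 < m)%N by rewrite addn_gt0 muln_gt0 addn_gt0 n_gt0.
have mL k : measurable_fun setT (fun z : E => real_coords (z.1 : 'M[R[i]]_(n + n, n)) ord0 k).
  exact: (measurableT_comp (measurable_real_coords k) measurable_fst).
have mY k : measurable_fun setT (fun z : E => mxvec (z.2 : 'M[R]_(n + n, n)) ord0 k).
  exact: (measurableT_comp (measurable_target_coords k) measurable_snd).
(* A crude bound: it affects the number of cells but not the rate. *)
pose K := Btgt + Bin * \sum_i \sum_l `|pinvmx W l i|.
have K_sum0 : 0 <= \sum_i \sum_l `|pinvmx W l i| by do 2!apply: sumr_ge0 => ? _.
have x_le i z : X z -> `|x z ord0 i| <= K.
  move=> [Xz _]; have [Lz _ _] := X1P _ Xz.
  rewrite /x mxE (le_trans (ler_norm_sum _ _ _))// /K ler_wpDl ?(ltW Btgt_gt0)//.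
  rewrite [X in _ <= _ * X](bigD1 i)//= mulrDr ler_wpDr//.
    by rewrite mulr_ge0 ?(ltW Bin_gt0)//; do 2!apply: sumr_ge0 => ? _.
  rewrite mulr_sumr; apply: ler_sum => l _; rewrite normrM ler_wpM2r//.
  exact: le_trans (real_coords_le _ _) Lz.
have y_le k (z : E) : X z -> `|mxvec (z.2 : 'M[R]_(n + n, n)) ord0 k| <= K.
  move=> [_ Xz]; rewrite /K ler_wpDr ?mulr_ge0 ?(ltW Bin_gt0)//.
  exact: le_trans (mxvec_le_frobenius _ _) (X2P _ Xz).
have loss_le (h : H) z : X z -> loss (sval h) z <= Bout + Btgt.
  move=> [Xz1 Xz2]; apply: le_trans (frobeniusB_le _ _) _; apply: lerD.
    by have [_ + _] := X1P _ Xz1; apply; exact: svalP.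
  exact: X2P.
have lossE (h : H) (z : E) : X z -> loss (sval h) z =
    Num.sqrt (\sum_k ((x z *m C h) ord0 k - mxvec (z.2 : 'M[R]_(n + n, n)) ord0 k) ^+ 2).
  move=> Xz; rewrite /loss frobenius_mxvec xC//; congr Num.sqrt.
  by apply: eq_bigr => k _; rewrite linearB !mxE.
have mloss (h : H) : measurable_fun setT (loss (sval h) : E -> R).
  (* Measurability goes through the full matrix [T h], since the factorization through W is
     established only for data in X. *)
  rewrite (_ : loss (sval h) = Num.sqrt \o (fun z : E => \sum_k
    ((real_coords (z.1 : 'M[R[i]]_(n + n, n)) *m T h) ord0 k -
     mxvec (z.2 : 'M[R]_(n + n, n)) ord0 k) ^+ 2)); last first.
    apply/funext => z; rewrite /loss frobenius_mxvec /= -TE; congr Num.sqrt.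
    by apply: eq_bigr => k _; rewrite linearB !mxE.
  apply: measurableT_comp.
    exact: (continuous_measurable_fun (@sqrt_continuous R)).
  apply: measurable_sum => k; apply: measurable_funX; apply: measurable_funB => //.
  exact: measurable_fun_mulmx.
have xC_le h z : X z -> \sum_k (x z *m C h) ord0 k ^+ 2 <= B ^+ 2.
  by move=> Xz; rewrite xC//; apply: sum_mxvec; apply: h_le; case: Xz.
have C_le h i : \sum_k C h i k ^+ 2 <= B ^+ 2.
  have [L XL WL] := W_X i.
  have -> : \sum_k C h i k ^+ 2 = \sum_k mxvec (sval h L) ord0 k ^+ 2.
    apply: eq_bigr => k _; congr (_ ^+ 2).
    by rewrite TE WL /C -row_mul [RHS]mxE.
  exact/sum_mxvec/h_le.
have P_gt0 : (0 < (n + n) * n)%N by rewrite muln_gt0 addn_gt0 n_gt0.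
have NR : 0 < N%:R :> R by rewrite ltr0n.
have B_gt0 : 0 < B by rewrite divr_gt0// mulr_gt0.
(* The ridge is the inverse of the ambient dimension m, because q may be 0. *)
have s_gt0 : 0 < m%:R^-1 :> R by rewrite invr_gt0 ltr0n.
have sq_le1 : m%:R^-1 * q%:R <= 1 :> R.
  by rewrite mulrC ler_pdivrMr ?ltr0n// mul1r ler_nat.
have B1_gt0 : 0 < Bout + Btgt by rewrite addr_gt0.
(* Of the order of the minimizer of [t B^2 + 2 P^2 q N / t] for the largest q, 4 n^2, where P is 2
   n^2. *)
pose t := 4 * n%:R ^+ 3 * Num.sqrt N%:R / B.
have t_gt0 : 0 < t by rewrite divr_gt0// !mulr_gt0 ?exprn_gt0 ?sqrtr_gt0 ?ltr0n.
(* The discretization error has the form of the capacity term, with constant 1 in place of 48. *)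
pose eta := Bout * alpha^-1 * n%:R ^+ 3 * N%:R `^ (- 2^-1).
have eta_gt0 : 0 < eta.
  by rewrite !mulr_gt0 ?invr_gt0 ?exprn_gt0 ?powR_gt0 ?ltr0n.
have delta01 : 0 < delta < 1 by rewrite delta_gt0.
have mx i : measurable_fun setT (fun z => x z ord0 i) by exact: measurable_fun_mulmx.
have loss_ge0 (h : H) z : 0 <= loss (sval h) z by exact: frobenius_ge0.
have [G [mG PG GP]] := uniform_deviation S_iid N_gt0 mX X_full
  (exist _ h0 h0_net : H) P_gt0 mx mY B1_gt0 s_gt0 sq_le1 x_le y_le xC_le C_le
  mloss loss_ge0 loss_le lossE t_gt0 eta_gt0 delta01.
exists G; split => // w Gw h h_net.
apply: le_trans (GP w Gw (exist _ h h_net)) _.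
rewrite lee_fin /empirical_loss /= -addrA lerD2l.
have c1_ge0 : 0 <= c1_const w1 w2 BU BM BV BD Bin * Bout^-1 * n%:R `^ (- (3 / 2)).
  rewrite !mulr_ge0 ?powR_ge0 ?invr_ge0 ?(ltW Bout_gt0) ?(ltW Bin_gt0) ?exprn_ge0
    ?pi_ge0 ?addr_ge0 ?sqrtr_ge0 ?(ltW BU_gt0) ?(ltW BM_gt0) ?(ltW BV_gt0)//.
exact: (deviation_rate Bout_gt0 B1_gt0 alpha_gt0 c1_ge0 n_gt0 N_gt0 q_le delta01 erefl erefl).
Qed.
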